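(* Let $D\subset\mathbb{C}^N$ be a domain with $D=\operatorname{int}(\overline{D})$, and let $\{D_n\}_{n=1}^\infty$ be a sequence of domains in $\mathbb{C}^N$ which approximates $D$ from outside. Let $\mu\in AW(\overline{D})$ and let $\mu_k\in AW(D_k)$ for $k\in\mathbb{N}$. Suppose that $H(\overline{D},\mu)$ is dense in $L^2(\overline{D},\mu)$. Let $\widetilde{\mu}_k$ and $\widetilde{\mu}$ be the extensions of $\mu_k$ and $\mu$ defined in the context. Assume that for some $p\in\mathbb{N}$ a) $\widetilde{\mu}(z)\le\widetilde{\mu}_m(z)\le\mu_p(z)$ for all $m\ge p$ and $z\in D_p$; b) $\mu_p\in L^1(D_p)$; c) $\widetilde{\mu}_k\to\widetilde{\mu}$ as $k\to\infty$ pointwise almost everywhere in $D_p$. Then $$\lim_{m\to\infty}K_{D_m,\mu_m}=K_{D,\mu}$$ locally uniformly on $D\times D$.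
   Context: A sequence of domains $\{D_n\}$ approximates $D$ from outside if $D\subset D_n$ for all $n$, and for each open $G$ with $\overline{D}\subset G$ one has $D\subset D_m\Subset G$ for all sufficiently large $m$ (where $D_m\Subset G$ means that $\overline{D_m}$ is a compact subset of $G$). A weight on an open set $\Omega\subset\mathbb{C}^N$ is a Lebesgue measurable, real-valued, positive function on $\Omega$ (two weights are identified if equal almost everywhere). For a weight $\mu$ on an open set $\Omega$, the usual weighted space of Lebesgue measurable complex-valued functions has norm $\|f\|_\mu^2=\int_\Omega|f|^2\mu\,dV$ ($dV$ is Lebesgue measure) and scalar product $\langle f|g\rangle_\mu=\int_\Omega f\overline{g}\,\mu\,dV$; $L^2_H(\Omega,\mu)$ is its subspace of functions holomorphic on $\Omega$. A weight $\mu$ is admissible, written $\mu\in AW(\Omega)$, if $L^2_H(\Omega,\mu)$ is a closed subspace of the weighted $L^2$ space and for every $z\in \Omega$ the evaluation functional $f\mapsto f(z)$ is continuous on $L^2_H(\Omega,\mu)$. For a Lebesgue measurable set $E\subset\mathbb{C}^N$, $\mu\in AW(E)$ means that there are an open set $W\supset E$ and $\nu\in AW(W)$ with $\nu_{|E}=\mu$. In this statement $L^2(E,\mu)$ (for $E=\overline{D}$) denotes the Hilbert space of all complex-valued functions which are square integrable on $E$ with respect to $\mu\,dV$ and holomorphic in the interior of $E$; $H(E,\mu)$ is the subset of $L^2(E,\mu)$ consisting of functions possessing a holomorphic extension to an open neighborhood of $E$. For an admissible weight $\mu$ on a domain $\Omega$ and $t\in \Omega$, if the class $\{f\in L^2_H(\Omega,\mu):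 f(t)=1\}$ is nonempty, it has a unique element $\phi_\mu(\cdot,t)$ of minimal norm, and the weighted Bergman kernel is $K_{\Omega,\mu}(z,t)=\phi_\mu(z,t)/\|\phi_\mu(\cdot,t)\|_\mu^2$; if the class is empty, $K_{\Omega,\mu}(\cdot,t)\equiv 0$. Equivalently, $K_{\Omega,\mu}$ is the reproducing kernel of $L^2_H(\Omega,\mu)$: $K_{\Omega,\mu}(\cdot,t)\in L^2_H(\Omega,\mu)$ and $f(t)=\langle f|K_{\Omega,\mu}(\cdot,t)\rangle_\mu$ for all $f\in L^2_H(\Omega,\mu)$. For $\mu\in AW(\overline D)$, $K_{D,\mu}$ means the weighted Bergman kernel of $D$ with weight $\mu_{|D}$. Extensions of weights: $\widetilde{\mu}_1=\mu_1$ on $D_1$, and for $k\ge2$, $\widetilde{\mu}_k=\mu_k$ on $D_k$ and $\widetilde{\mu}_k=\widetilde{\mu}_{k-1}$ on $(D_1\cup\dots\cup D_{k-1})\setminus D_k$; thus $\widetilde{\mu}_k$ is defined on $D_1\cup\dots\cup D_k$. The extension $\widetilde{\mu}$ equals $\mu$ on $\overline{D}$, and for $z\in\bigcup_n D_n\setminus\overline{D}$ it is $\widetilde{\mu}(z)=\mu_j(z)$, where $j$ is the smallest index with $z\in D_j$.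
   Formalization: Adds that D_m ⊂ D_p for all sufficiently large m (otherwise μ_m on D_m \ D_p is unconstrained and the claim fails, e.g. for discs with D_p = D), and states explicitly that μ restricted to D is an admissible weight on D, which the definition of K_{D,μ} needs. *)

(* Defs.v *)
From HB Require Import structures.
From mathcomp Require Import all_boot all_order all_algebra.
From mathcomp Require Import complex.
From mathcomp Require Import all_classical all_reals all_analysis.

Set Implicit Arguments.
Unset Strict Implicit.
Unset Printing Implicit Defensive.
Import Order.TTheory GRing.Theory Num.Theory.
Import numFieldNormedType.Exports.

Local Open Scope classical_set_scope.
Local Open Scope ring_scope.

(* Makes 'rV[R[i]]_N a normed R[i]-module, so that [differentiable] at a
   function 'rV[R[i]]_N -> R[i] is complex (Frechet) differentiability. *)
HB.instance Definition _ (R : realType) := NormedModule.copy R[i] R[i]^o.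

(* The space is 'rV[R[i]]_n.+1, that is C^N with N = n + 1 >= 1. *)
Notation Cn R n := 'rV[R[i]]_n.+1.

Definition cbox (R : realType) (n : nat) (a b : Cn R n) : set (Cn R n) :=
  [set z | forall j,
     complex.Re (z 0 j) \in `]complex.Re (a 0 j), complex.Re (b 0 j)] /\
     complex.Im (z 0 j) \in `]complex.Im (a 0 j), complex.Im (b 0 j)]].

Definition cbox_vol (R : realType) (n : nat) (a b : Cn R n) : R :=
  \prod_(j < n.+1)
    (Num.max 0 (complex.Re (b 0 j) - complex.Re (a 0 j)) *
     Num.max 0 (complex.Im (b 0 j) - complex.Im (a 0 j))).

(* N-dimensional complex Lebesgue outer measure: countable covers by half-open
   boxes of R^(2N). *)
Definition lebesgue_outer (R : realType) (n : nat) (A : set (Cn R n)) : \bar R :=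
  ereal_inf [set (\sum_(k <oo) (cbox_vol (F k).1 (F k).2)%:E)%E |
    F in [set F : nat -> Cn R n * Cn R n |
            A `<=` \bigcup_k cbox (F k).1 (F k).2]].

Section lebesgue_outer_measure.
Local Open Scope ereal_scope.
Variables (R : realType) (n : nat).
Local Notation C := (Cn R n).
Local Notation lo := (@lebesgue_outer R n).

Lemma cbox_vol_ge0 (a b : C) : 0 <= (cbox_vol a b)%:E.
Proof.
rewrite lee_fin; apply: prodr_ge0 => j _.
by apply: mulr_ge0; rewrite le_max lexx.
Qed.

Lemma cbox_vol00 (a : C) : cbox_vol a a = 0%R.
Proof.
by rewrite /cbox_vol (bigD1 ord0)//= !subrr maxxx !mul0r.
Qed.

Lemma lebesgue_outer_ge0 (A : set C) : 0 <= lo A.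
Proof.
apply: le_ereal_inf_tmp => x [F _ <-]; apply: nneseries_ge0 => k _ _.
exact: cbox_vol_ge0.
Qed.

Lemma lebesgue_outer0 : lo set0 = 0.
Proof.
apply/eqP; rewrite eq_le lebesgue_outer_ge0 andbT.
apply: ereal_inf_lbound; exists (fun=> (0%R, 0%R)) => //=.
by rewrite eseries0// => k _ _; rewrite cbox_vol00.
Qed.

Lemma le_lebesgue_outer : {homo lo : A B / A `<=` B >-> A <= B}.
Proof.
move=> A B AB; apply/ereal_inf_le_tmp => x [F BF <-]; exists F => //.
exact: subset_trans BF.
Qed.

Lemma lebesgue_outer_sigma_subadditive : sigma_subadditive lo.
Proof.
move=> A; have [[i ioo]|] := pselect (exists i, lo (A i) = +oo).
  rewrite (eseries_pinfty _ _ ioo) ?leey// => k _.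
  by rewrite -ltNye (lt_le_trans _ (lebesgue_outer_ge0 _)).
rewrite -forallNE => Aoo.
suff add2e (e : {posnum R}) :
    lo (\bigcup_k A k) <= \sum_(i <oo) lo (A i) + e%:num%:E.
  by apply/lee_addgt0Pr => _/posnumP[].
rewrite (le_trans _ (epsilon_trick _ _ _))//; last first.
  by move=> k; exact: lebesgue_outer_ge0.
pose P k (F : nat -> C * C) :=
  A k `<=` \bigcup_i cbox (F i).1 (F i).2 /\
  \sum_(i <oo) (cbox_vol (F i).1 (F i).2)%:E <=
    lo (A k) + (e%:num / (2 ^ k.+1)%:R)%:E.
have [G PG] : {G : nat -> nat -> C * C & forall k, P k (G k)}.
  apply: (@choice _ _ P) => k; rewrite /P /lebesgue_outer.
  set S := (X in ereal_inf X); move infS : (ereal_inf S) => iS.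
  case: iS infS => [r Sr|Soo|Soo].
  - have en1 : (0 < e%:num / (2 ^ k.+1)%:R)%R by [].
    have /(lb_ereal_inf_adherent en1) : ereal_inf S \is a fin_num by rewrite Sr.
    move=> [x [F AF <-] xS].
    by exists F; split => //; rewrite -Sr; exact/ltW.
  - by have := Aoo k; rewrite /lebesgue_outer Soo.
  - by have := lebesgue_outer_ge0 (A k); rewrite /lebesgue_outer Soo.
pose v (x : nat * nat) := (cbox_vol (G x.1 x.2).1 (G x.1 x.2).2)%:E.
have v_ge0 x : 0 <= v x by exact: cbox_vol_ge0.
apply: (@le_trans _ _ (\esum_(i in setT) v i)).
  apply: ereal_inf_lbound => /=.
  have /card_esym/ppcard_eqP[f] := card_nat2.
  exists (fun k => G (f k).1 (f k).2).
    move=> t [i _ /((PG i).1)[j _ tij]]; exists (f^-1%FUN (i, j)) => //=.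
    by rewrite invK ?inE.
  rewrite -[X in X = _]/(\sum_(k <oo) (v \o f) k).
  by rewrite -(esum_pred_image v _ xpredT) ?[fun=> _]set_true// image_eq.
rewrite (_ : esum _ _ = \sum_(i <oo) \sum_(j <oo) v (i, j)); last first.
  pose J : nat -> set (nat * nat) := fun i => [set (i, j) | j in setT].
  rewrite (_ : setT = \bigcup_k J k); last first.
    by rewrite predeqE => -[a b]; split => // _; exists a => //; exists b.
  rewrite esum_bigcupT //=; last first.
    apply/trivIsetP => i j _ _ ij.
    rewrite predeqE => -[k m] /=; split => //= -[] [_] _ [<-{k} _].
    by move=> [m' _] [] /esym/eqP; rewrite (negbTE ij).
  rewrite -(image_id [set: nat]) -fun_true esum_pred_image//; last first.
    by move=> k _; exact: esum_ge0.
  apply: eq_eseriesr => /= j _.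
  rewrite -(esum_pred_image v (pair j) predT)//=; last first.
    by move=> ? ? _ _; exact: (@can_inj _ _ _ snd).
  by congr esum; rewrite predeqE => -[a b]; split; move=> [i _ <-]; exists i.
apply: lee_nneseries => k _; last exact: (PG k).2.
by move=> _; apply: nneseries_ge0 => m *; exact: v_ge0.
Qed.

HB.instance Definition _ := isOuterMeasure.Build R C lo
  lebesgue_outer0 lebesgue_outer_ge0 le_lebesgue_outer
  lebesgue_outer_sigma_subadditive.

(* The canonical sigma-algebra on C^N is the Caratheodory one, i.e. that of all
   Lebesgue measurable sets (not only the Borel ones). *)
HB.instance Definition _ := Measurable.copy C (caratheodory_type lo).

Definition lebesgue_Cn : set C -> \bar R := lo.

HB.instance Definition _ := isMeasure.Build _ C R lebesgue_Cn
  (@caratheodory_measure0 R C lo) (@caratheodory_measure_ge0 R C lo)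
  (@caratheodory_measure_sigma_additive R C lo).

End lebesgue_outer_measure.
Arguments lebesgue_Cn : clear implicits.

Section weighted_spaces.
Context {R : realType} {n : nat}.
Local Notation C := (Cn R n).
Local Notation dV := (lebesgue_Cn R n).
Implicit Types (E W : set C) (mu : C -> R) (f g h : C -> R[i]).

Definition cmeasurable_fun E f :=
  measurable_fun E (fun z => complex.Re (f z)) /\
  measurable_fun E (fun z => complex.Im (f z)).

Definition holomorphic_on W f := forall z, W z -> differentiable f z.

Definition weight W mu := measurable_fun W mu /\ forall z, W z -> 0 < mu z.

Definition sqwint E mu f : \bar R :=
  (\int[dV]_(z in E) (ComplexField.Normc.normc (f z) ^+ 2 * mu z)%:E)%E.

(* [sqwint] may be +oo, which [fine] sends to 0: only use [wnorm] on [L2]. *)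
Definition wnorm E mu f : R := Num.sqrt (fine (sqwint E mu f)).

Definition L2 E mu : set (C -> R[i]) :=
  [set f | cmeasurable_fun E f /\ (sqwint E mu f < +oo)%E].

Definition L2H W mu : set (C -> R[i]) :=
  [set f | L2 W mu f /\ holomorphic_on W f].

(* Sequential closedness in the weighted L^2 space of a.e. classes; as weights
   are positive, these are the classes for the Lebesgue measure. *)
Definition L2H_closed W mu :=
  forall (f : nat -> C -> R[i]) g, (forall k, L2H W mu (f k)) -> L2 W mu g ->
    wnorm W mu (fun z => f k z - g z) @[k --> \oo] --> 0 ->
    exists2 h, L2H W mu h & {ae dV, forall z, W z -> h z = g z}.

(* Continuity of f |-> f z on L2H for the weighted norm. *)
Definition eval_continuous W mu z :=
  forall f, L2H W mu f -> forall eps : R, 0 < eps -> exists2 delta : R, 0 < delta &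
    forall g, L2H W mu g -> wnorm W mu (fun w => g w - f w) < delta ->
      ComplexField.Normc.normc (g z - f z) < eps.

Definition admissible W mu :=
  [/\ open W, weight W mu, L2H_closed W mu &
      forall z, W z -> eval_continuous W mu z].

Definition admissible_on E mu :=
  exists W nu, [/\ open W, E `<=` W, admissible W nu &
                   forall z, E z -> nu z = mu z].

Definition L2int E mu : set (C -> R[i]) :=
  [set f | L2 E mu f /\ holomorphic_on E° f].

Definition Hext E mu : set (C -> R[i]) :=
  [set f | L2int E mu f /\
    exists U F, [/\ open U, E `<=` U, holomorphic_on U F &
                    forall z, E z -> F z = f z]].

Definition Hext_dense E mu :=
  forall f, L2int E mu f -> forall eps : R, 0 < eps ->
    exists2 g, Hext E mu g & wnorm E mu (fun z => f z - g z) < eps.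

Definition norm1_at W mu (t : C) : set (C -> R[i]) :=
  [set f | L2H W mu f /\ f t = 1].

(* Functions are total, so the minimizer is unique only on W; off W its values
   (hence those of the kernel) are unspecified. *)
Definition minimizer W mu (t : C) : C -> R[i] :=
  xget (fun=> 0) [set f | norm1_at W mu t f /\
    forall g, norm1_at W mu t g -> wnorm W mu f <= wnorm W mu g].

Definition bergman_kernel W mu (z t : C) : R[i] :=
  if `[< norm1_at W mu t !=set0 >]
  then minimizer W mu t z / (wnorm W mu (minimizer W mu t) ^+ 2)%:C%C
  else 0.

Definition domain W := [/\ open W, connected W & W !=set0].

Definition approximates_from_outside (D_ : nat -> set C) (D : set C) :=
  (forall k, D `<=` D_ k) /\
  forall G, open G -> closure D `<=` G ->
    \forall m \near \oo,
      [/\ D `<=` D_ m, compact (closure (D_ m)) & closure (D_ m) `<=` G].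

(* Sequences are indexed from 0: [D_ k] and [mu_ k] are the (k+1)-st terms.
   Off D_ 0 `|` ... `|` D_ k the value of [ext_weight k] is irrelevant. *)
Fixpoint ext_weight (D_ : nat -> set C) (mu_ : nat -> C -> R) (k : nat)
    (z : C) : R :=
  if k is k'.+1 then
    if `[< D_ k z >] then mu_ k z else ext_weight D_ mu_ k' z
  else mu_ 0%N z.

Definition first_index (D_ : nat -> set C) (z : C) : nat :=
  xget 0%N [set j | D_ j z /\ forall i, D_ i z -> (j <= i)%N].

Definition ext_weight_lim (D : set C) (D_ : nat -> set C) (mu : C -> R)
    (mu_ : nat -> C -> R) (z : C) : R :=
  if `[< closure D z >] then mu z else mu_ (first_index D_ z) z.

End weighted_spaces.

Definition locally_uniform_cvg {T : topologicalType} {U : uniformType}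
    (A : set T) (F : nat -> T -> U) (f : T -> U) :=
  forall x, A x -> exists2 V, nbhs x V & {uniform (V `&` A), F @ \oo --> f}.

(* Main.v *)
Require Import Defs.
From HB Require Import structures.
From mathcomp Require Import all_boot all_order all_algebra.
From mathcomp Require Import complex.
From mathcomp Require Import all_classical all_reals all_analysis.
From mathcomp Require Import measurable_realfun ring lra.
Import Order.TTheory GRing.Theory Num.Theory.
Import numFieldNormedType.Exports.
Local Open Scope classical_set_scope.
Local Open Scope ring_scope.

(* For t in D put k(t) = K_{D,mu}(t,t) and k_m(t) = K_{D_m,mu_m}(t,t).  As
   mu <= mu_m on D, restriction to D does not increase norms; hence k_m <= k, and
   the parallelogram law gives
     |K_{D_m,mu_m}(z,t) - K_{D,mu}(z,t)|^2 <= 2 k(z) (k(t) - k_m(t)),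
   so it suffices that k_m -> k locally uniformly and that k is locally bounded.
   By density, K_{D,mu}(.,t) extended by 0 is approximated by a function F that is
   holomorphic near the closure of D; dominated convergence bounds the limit of
   its norms on D_m by its norm on the closure, and testing k_m with F bounds k_m
   from below near t.  The upper semicontinuity of k that makes this uniform comes
   from the gliding hump argument for the difference quotients of the evaluation
   functionals at t: they are pointwise bounded because the functions are complex
   differentiable, so no Cauchy estimate is involved. *)

Set Implicit Arguments.
Unset Strict Implicit.
Unset Printing Implicit Defensive.

(** * Lebesgue measurability of open sets *)

(** The boundary of D may have positive measure, and this shapes the lower bound: norms on D_m are
    controlled by norms on the closure of D, so a test function has to be small on the boundary too.
    Density achieves this when applied to the extension by 0, which is holomorphic in the interior
    of the closure because D equals that interior. Since the norms on D_m only have to be bounded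
    from above, it suffices that the positive part of mu_m 1_{D_m} - mu 1_{cl D} tends to 0 in
    L^1(D_p). No scalar product occurs: kernels are built from minimizers, and the inequality
    |f(t)|^2 <= k(t) |f|^2, combined with the parallelogram law, takes the place of the reproducing
    property. A test function chosen at one point t serves all y near t because it is continuous
    there; k(y) itself is compared with k(t) by semicontinuity. *)

Section complex_norm.
Context {R : realType}.
Local Notation normc := ComplexField.Normc.normc.
Implicit Types z : R[i].

Lemma norm_normc z : `|z| = (normc z)%:C%C.
Proof. by []. Qed.

Lemma normc_ge0 z : 0 <= normc z.
Proof. by case: z => a b; exact: sqrtr_ge0. Qed.

Lemma normc_real (x : R) : normc x%:C%C = `|x|.
Proof. by rewrite /= expr0n/= addr0 sqrtr_sqr. Qed.

Lemma sqr_normc_ReIm z :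
  normc z ^+ 2 = complex.Re z ^+ 2 + complex.Im z ^+ 2.
Proof. by case: z => a b/=; rewrite sqr_sqrtr// addr_ge0// sqr_ge0. Qed.

Lemma normc_le_ReIm z : normc z <= `|complex.Re z| + `|complex.Im z|.
Proof.
rewrite -(@ler_pXn2r _ 2)// ?nnegrE ?normc_ge0 ?addr_ge0//.
rewrite sqr_normc_ReIm sqrrD !real_normK ?num_real//.
by rewrite lerD2r lerDl mulrn_wge0// mulr_ge0.
Qed.

Lemma Re_le_normc z : `|complex.Re z| <= normc z.
Proof.
rewrite -(@ler_pXn2r _ 2)// ?nnegrE ?normc_ge0//.
by rewrite sqr_normc_ReIm real_normK ?num_real// lerDl sqr_ge0.
Qed.

Lemma Im_le_normc z : `|complex.Im z| <= normc z.
Proof.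
rewrite -(@ler_pXn2r _ 2)// ?nnegrE ?normc_ge0//.
by rewrite sqr_normc_ReIm real_normK ?num_real// lerDr sqr_ge0.
Qed.

Lemma normcB_sym z w : normc (z - w) = normc (w - z).
Proof. by have := distrC z w; rewrite !norm_normc => -[]. Qed.

Lemma real_valued_lipschitz_continuous (g : R[i] -> R) :
  (forall z w, `|g z - g w| <= normc (z - w)) -> continuous g.
Proof.
move=> lip z; apply/(@cvgrPdist_lt _ _ _ (nbhs z)) => e e0.
apply/nbhs_ballP; exists e%:C%C => /=; first by rewrite ltcR.
move=> w; rewrite -ball_normE/= norm_normc ltcR; exact: le_lt_trans.
Qed.

Lemma Re_continuous : continuous (@complex.Re R : R[i] -> R).
Proof.
by apply: real_valued_lipschitz_continuous => z w; rewrite -raddfB Re_le_normc.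
Qed.

Lemma Im_continuous : continuous (@complex.Im R : R[i] -> R).
Proof.
by apply: real_valued_lipschitz_continuous => z w; rewrite -raddfB Im_le_normc.
Qed.

Lemma normc_continuous : continuous (@ComplexField.Normc.normc R).
Proof.
apply: real_valued_lipschitz_continuous => z w.
by have := ler_dist_dist z w; rewrite !norm_normc -raddfB normc_real lecR.
Qed.

End complex_norm.

Section lebesgue_measurability.
Context {R : realType} {n : nat}.
Local Notation C := (Cn R n).
Local Notation axes := (bool * 'I_n.+1)%type.
Implicit Types (x y : axes) (a b z : C).

(* The 2N real coordinates of C^N: [(true, j)] is the imaginary part of the
   j-th complex coordinate and [(false, j)] its real part. *)
Definition axis x z : R :=
  if x.1 then complex.Im (z 0 x.2) else complex.Re (z 0 x.2).

Definition of_axes (u : axes -> R) : C :=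
  \row_j Complex (u (false, j)) (u (true, j)).

Lemma axis_of_axes x u : axis x (of_axes u) = u x.
Proof. by case: x => -[] j; rewrite /axis mxE. Qed.

(** Cutting a box by a coordinate hyperplane changes one real coordinate of one vertex, to its [min]
    or [max] with the level of the cut. If the hyperplane misses the box, one of the pieces is
    empty. *)
Definition move_axis x (phi : R -> R) z : C :=
  of_axes (fun y => if y == x then phi (axis y z) else axis y z).

Lemma axis_move_axis x phi z y :
  axis y (move_axis x phi z) = if y == x then phi (axis y z) else axis y z.
Proof. exact: axis_of_axes. Qed.

Lemma cbox_axes a b z :
  cbox a b z <-> forall x, axis x z \in `]axis x a, axis x b].
Proof.
split=> [abz [[] j]|abz j]; [exact: (abz j).2|exact: (abz j).1|].
by split; [exact: (abz (false, j))|exact: (abz (true, j))].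
Qed.

Lemma cbox_vol_axes a b :
  cbox_vol a b = \prod_x Num.max 0 (axis x b - axis x a).
Proof.
rewrite /cbox_vol big_split/=.
rewrite -(pair_bigA _ (fun i j => Num.max 0 (axis (i, j) b - axis (i, j) a)))/=.
by rewrite big_bool mulrC.
Qed.

Lemma cbox_cut_le a b x (c : R) :
  cbox a b `&` [set z | axis x z <= c] `<=` cbox a (move_axis x (Num.min c) b).
Proof.
move=> z [/cbox_axes abz /= zc]; apply/cbox_axes => y.
have := abz y; rewrite !in_itv/= axis_move_axis => /andP[-> yb]/=.
by case: eqP yb => // -> yb; rewrite le_min zc.
Qed.

Lemma cbox_cut_gt a b x (c : R) :
  cbox a b `&` ~` [set z | axis x z <= c] `<=`
  cbox (move_axis x (Num.max c) a) b.
Proof.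
move=> z [/cbox_axes abz /= /negP]; rewrite -ltNge => zc; apply/cbox_axes => y.
have := abz y; rewrite !in_itv/= axis_move_axis => /andP[ay ->]; rewrite andbT.
by case: eqP ay => // -> ay; rewrite gt_max zc.
Qed.

(** The three volumes share every factor except the one of axis x, where an interval is split at c.
    The truncation at 0 in [cbox_vol] gives an empty piece volume 0. *)
Lemma cbox_vol_cut a b x (c : R) :
  cbox_vol a (move_axis x (Num.min c) b) +
  cbox_vol (move_axis x (Num.max c) a) b = cbox_vol a b.
Proof.
pose F y := Num.max 0 (axis y b - axis y a).
have E a' b' : (forall y, y != x -> axis y a' = axis y a) ->
    (forall y, y != x -> axis y b' = axis y b) ->
    cbox_vol a' b' = Num.max 0 (axis x b' - axis x a') * \prod_(y | y != x) F y.
  move=> aE bE; rewrite cbox_vol_axes (bigD1 x)//=; congr (_ * _).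
  by apply: eq_bigr => y yx; rewrite aE ?bE.
have mE phi z y : y != x -> axis y (move_axis x phi z) = axis y z.
  by move=> /negbTE yx; rewrite axis_move_axis yx.
have mxE phi z : axis x (move_axis x phi z) = phi (axis x z).
  by rewrite axis_move_axis eqxx.
rewrite (E a (move_axis x (Num.min c) b))//; last exact: mE.
rewrite (E (move_axis x (Num.max c) a) b)//; last exact: mE.
rewrite (E a b)// -mulrDl !mxE; congr (_ * _).
move: (axis x a) (axis x b) => u v.
rewrite /Num.max /Num.min.
by case: (ltP c v) => ?; case: (ltP u c) => ?; do !case: ifPn; rewrite -?leNgt; lra.
Qed.

(** Caratheodory's criterion: cutting each box of a cover of X along the hyperplane covers the two
    parts of X separately, with the same total volume. *)
Lemma measurable_halfspace x (c : R) : measurable [set z : C | axis x z <= c].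
Proof.
apply: (@le_caratheodory_measurable R C (@lebesgue_outer R n)) => X.
apply: le_ereal_inf_tmp => _ [F XF <-].
pose F1 k := ((F k).1, move_axis x (Num.min c) (F k).2).
pose F2 k := (move_axis x (Num.max c) (F k).1, (F k).2).
apply: (@le_trans _ _ (\sum_(k <oo) (cbox_vol (F1 k).1 (F1 k).2)%:E +
                       \sum_(k <oo) (cbox_vol (F2 k).1 (F2 k).2)%:E)%E).
  apply: leeD; apply: ereal_inf_lbound; [exists F1|exists F2] => //= z [Xz cz];
    have [k _ Fz] := XF z Xz; exists k => //.
  - exact: cbox_cut_le.
  - exact: cbox_cut_gt.
rewrite -nneseriesD; last 2 first.
- by move=> k _ _; exact: cbox_vol_ge0.
- by move=> k _ _; exact: cbox_vol_ge0.
by apply: lee_nneseries => k *; rewrite -EFinD ?cbox_vol_cut// lee_fin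
  -lee_fin cbox_vol_ge0.
Qed.

Lemma measurable_cbox a b : measurable (cbox a b : set C).
Proof.
have -> : cbox a b = \bigcap_(x in [set: axes])
    ([set z | axis x z <= axis x b] `\` [set z | axis x z <= axis x a]).
  apply/seteqP; split=> z.
    move=> /cbox_axes abz x _; have := abz x; rewrite in_itv/= => /andP[az ->].
    by split=> //; apply/negP; rewrite -ltNge.
  move=> abz; apply/cbox_axes => x; have [/= zb /negP] := abz x I.
  by rewrite -ltNge in_itv/= zb => ->.
apply: fin_bigcap_measurable => // x _.
by apply: measurableD; exact: measurable_halfspace.
Qed.

Lemma ball_cbox (z : C) (e : R[i]) : 0 < e ->
  exists d : R, 0 < d /\ forall a b,
    (forall x, axis x z - d < axis x a < axis x z) ->
    (forall x, axis x z < axis x b < axis x z + d) ->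
    cbox a b z /\ cbox a b `<=` ball z e.
Proof.
move=> e0; exists (complex.Re e / 2).
have [eI eR] : complex.Im e = 0 /\ 0 < complex.Re e.
  by move: e0; rewrite ltcE/= => /andP[/eqP].
have d0 : 0 < complex.Re e / 2 by rewrite divr_gt0.
split=> // a b za zb; split.
  by apply/cbox_axes => x; have := za x; have := zb x;
    rewrite in_itv/= => /andP[+ _] /andP[_ ->] => /ltW.
move=> y /cbox_axes aby; split=> // i j; rewrite (ord1 i).
rewrite -ball_normE/= norm_normc ltcE/= eI eqxx/=.
apply: le_lt_trans (normc_le_ReIm _) _.
have close x : `|axis x z - axis x y| < complex.Re e / 2.
  have := aby x; have := za x; have := zb x; rewrite in_itv/=.
  by rewrite ltr_norml => /andP[? ?] /andP[? ?] /andP[? ?]; apply/andP; lra.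
have := close (false, j); have := close (true, j); rewrite /axis/= => + +.
by case: (z 0 j) => ? ?; case: (y 0 j) => ? ?/=; lra.
Qed.

(* An open set is the union of the boxes with rational vertices that it
   contains. *)
Lemma open_measurable_Cn (U : set C) : open U -> measurable U.
Proof.
move=> oU.
pose corner (r : {ffun axes -> rat}) : C := of_axes (fun x => ratr (r x)).
pose B := [set r : {ffun axes -> rat} * {ffun axes -> rat} |
  cbox (corner r.1) (corner r.2) `<=` U].
have -> : U = \bigcup_(r in B) cbox (corner r.1) (corner r.2).
  apply/seteqP; split=> [z Uz|z [r Br]]; last exact: Br.
  have /nbhs_ballP[e e0 eU] : nbhs z U by exact: open_nbhs_nbhs.
  have [d [d0 dP]] := ball_cbox z e0.
  have [ra raP] : {ra : axes -> rat &
      forall x, axis x z - d < ratr (ra x) < axis x z}.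
    apply: (@choice _ _ (fun x (q : rat) => axis x z - d < ratr q < axis x z)) => x.
    have : axis x z - d < axis x z by lra.
    by move=> /rat_in_itvoo[q]; rewrite in_itv/= => ?; exists q.
  have [rb rbP] : {rb : axes -> rat &
      forall x, axis x z < ratr (rb x) < axis x z + d}.
    apply: (@choice _ _ (fun x (q : rat) => axis x z < ratr q < axis x z + d)) => x.
    have : axis x z < axis x z + d by lra.
    by move=> /rat_in_itvoo[q]; rewrite in_itv/= => ?; exists q.
  have [] := dP (corner (finfun ra)) (corner (finfun rb)).
  - by move=> x; rewrite axis_of_axes ffunE.
  - by move=> x; rewrite axis_of_axes ffunE.
  move=> zab abU; exists (finfun ra, finfun rb) => //=.
  exact: subset_trans abU eU.
rewrite bigcup_mkcond; apply: countable_bigcupT_measurable => // r.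
by case: ifP => // _; exact: measurable_cbox.
Qed.

Lemma closed_measurable_Cn (U : set C) : closed U -> measurable U.
Proof.
by move=> cU; rewrite -(setCK U); apply/measurableC/open_measurable_Cn/closed_openC.
Qed.

Lemma continuous_measurable_Cn (W : set C) (f : C -> R) : open W ->
  (forall z, W z -> {for z, continuous f}) -> measurable_fun W f.
Proof.
move=> oW cf mW; apply: (measurability _ (RGenOInfty.measurableE R)) => //.
move=> _ [_ [c ->] <-]; apply: open_measurable_Cn.
rewrite openE => z [Wz fz]; apply: filterI; first exact: open_nbhs_nbhs.
apply: (cf z Wz); apply: open_nbhs_nbhs; split=> //.
Qed.

Lemma holomorphic_cmeasurable (W : set C) (f : C -> R[i]) : open W ->
  holomorphic_on W f -> cmeasurable_fun W f.
Proof.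
move=> oW hf; split; apply: continuous_measurable_Cn => // z Wz.
  apply: continuous_comp; first exact/differentiable_continuous/hf.
  exact: Re_continuous.
apply: continuous_comp; first exact/differentiable_continuous/hf.
exact: Im_continuous.
Qed.

End lebesgue_measurability.

(** * Weighted norms *)

Section weighted_norm.
Context {R : realType} {n : nat}.
Local Notation C := (Cn R n).
Local Notation dV := (lebesgue_Cn R n).
Local Notation normc := ComplexField.Normc.normc.
Variables (E : set C) (mu : C -> R).
Hypotheses (mE : measurable E) (wmu : weight E mu).
Implicit Types f g : C -> R[i].

Lemma sqwint_ge0 f : (0 <= sqwint E mu f)%E.
Proof.
apply: integral_ge0 => z Ez; rewrite lee_fin mulr_ge0 ?exprn_ge0 ?normc_ge0//.
exact/ltW/wmu.2.
Qed.

Lemma wnorm_ge0 f : 0 <= wnorm E mu f.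
Proof. exact: sqrtr_ge0. Qed.

Lemma sqwint_wnorm f : L2 E mu f -> sqwint E mu f = (wnorm E mu f ^+ 2)%:E.
Proof.
move=> [_ foo]; rewrite /wnorm sqr_sqrtr ?fine_ge0 ?sqwint_ge0//.
by rewrite fineK// ge0_fin_numE ?sqwint_ge0.
Qed.

Lemma eq_sqwint f g : (forall z, E z -> f z = g z) ->
  sqwint E mu f = sqwint E mu g.
Proof. by move=> fg; apply: eq_integral => z /[!inE] Ez; rewrite fg. Qed.

Lemma eq_wnorm f g : (forall z, E z -> f z = g z) ->
  wnorm E mu f = wnorm E mu g.
Proof. by move=> fg; rewrite /wnorm (eq_sqwint fg). Qed.

Lemma cmeasurable_normc2 f : cmeasurable_fun E f ->
  measurable_fun E (fun z => normc (f z) ^+ 2).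
Proof.
move=> [mr mi]; under eq_fun do rewrite sqr_normc_ReIm.
by apply: measurable_funD; exact: measurable_funX.
Qed.

Lemma sqwint_measurable f : cmeasurable_fun E f ->
  measurable_fun E (fun z => (normc (f z) ^+ 2 * mu z)%:E).
Proof.
move=> mf; apply/measurable_EFinP; apply: measurable_funM; last exact: wmu.1.
exact: cmeasurable_normc2.
Qed.

Lemma cmeasurable_funD f g : cmeasurable_fun E f -> cmeasurable_fun E g ->
  cmeasurable_fun E (fun z => f z + g z).
Proof.
move=> [fr fi] [gr gi]; split; under eq_fun do rewrite raddfD;
  exact: measurable_funD.
Qed.

Lemma cmeasurable_funZ (c : R[i]) f : cmeasurable_fun E f ->
  cmeasurable_fun E (fun z => c * f z).
Proof.
case: c => a b [fr fi]; split.
  have -> : (fun z => complex.Re (Complex a b * f z)) =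
      (fun z => a * complex.Re (f z)) \- (fun z => b * complex.Im (f z)).
    by apply/funext => z /=; case: (f z) => ? ?.
  by apply: measurable_funB; apply: measurable_funM.
have -> : (fun z => complex.Im (Complex a b * f z)) =
    (fun z => a * complex.Im (f z)) \+ (fun z => b * complex.Re (f z)).
  by apply/funext => z /=; case: (f z) => ? ?/=.
by apply: measurable_funD; apply: measurable_funM.
Qed.

(** Young's inequality with a free parameter; choosing s after integration yields the triangle
    inequality without Cauchy-Schwarz. *)
Lemma normc_sumZ (a b : R[i]) (s : R) : 0 < s ->
  normc (a + b) ^+ 2 <= (1 + s) * normc a ^+ 2 + (1 + s^-1) * normc b ^+ 2.
Proof.
move=> s0; rewrite !sqr_normc_ReIm !raddfD/=.
have key (x y : R) : (x + y) ^+ 2 <= (1 + s) * x ^+ 2 + (1 + s^-1) * y ^+ 2.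
  rewrite -subr_ge0.
  have -> : (1 + s) * x ^+ 2 + (1 + s^-1) * y ^+ 2 - (x + y) ^+ 2 =
      s^-1 * (s * x - y) ^+ 2 by field; rewrite gt_eqF.
  by rewrite mulr_ge0 ?sqr_ge0// invr_ge0 ltW.
have := key (complex.Re a) (complex.Re b).
have := key (complex.Im a) (complex.Im b).
by rewrite !mulrDr; lra.
Qed.

Lemma normc_parallelogram (a b : R[i]) :
  normc (a + b) ^+ 2 + normc (a - b) ^+ 2 =
  2 * normc a ^+ 2 + 2 * normc b ^+ 2.
Proof. by rewrite !sqr_normc_ReIm !raddfD !raddfN/=; ring. Qed.

(** The parallelogram law, homogeneity and the bound on sums all integrate a pointwise relation
    between squared moduli; this is the linearity they share. *)
Lemma sqwint_lincomb (s t : R) f g : 0 <= s -> 0 <= t ->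
  cmeasurable_fun E f -> cmeasurable_fun E g ->
  (\int[dV]_(z in E)
     ((s * normc (f z) ^+ 2 + t * normc (g z) ^+ 2) * mu z)%:E =
   s%:E * sqwint E mu f + t%:E * sqwint E mu g)%E.
Proof.
move=> s0 t0 mf mg.
have q0 h z : E z -> (0 <= (normc (h z) ^+ 2 * mu z)%:E)%E.
  by move=> Ez; rewrite lee_fin mulr_ge0 ?sqr_ge0// ltW// wmu.2.
have sq0 (r : R) h z : 0 <= r -> E z ->
    (0 <= r%:E * (normc (h z) ^+ 2 * mu z)%:E)%E.
  by move=> r0 Ez; rewrite mule_ge0 ?q0.
have mq h : cmeasurable_fun E h ->
  measurable_fun E (fun z => (normc (h z) ^+ 2 * mu z)%:E) by exact: sqwint_measurable.
have mZ (r : R) h : cmeasurable_fun E h ->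
    measurable_fun E (fun z => r%:E * (normc (h z) ^+ 2 * mu z)%:E)%E.
  by move=> mh; apply: measurable_funeM; exact: mq.
rewrite /sqwint -(ge0_integralZl_EFin dV mE (q0 f) (mq _ mf) s0).
rewrite -(ge0_integralZl_EFin dV mE (q0 g) (mq _ mg) t0).
rewrite -(ge0_integralD dV mE (fun z => sq0 s f z s0) (mZ s _ mf)
  (fun z => sq0 t g z t0) (mZ t _ mg)).
apply: eq_integral => z _; rewrite -!EFinM -EFinD; congr EFin; ring.
Qed.

Lemma sqwint_parallelogram f g : cmeasurable_fun E f -> cmeasurable_fun E g ->
  (sqwint E mu (fun z => f z + g z)%R + sqwint E mu (fun z => f z - g z)%R =
   2%:E * sqwint E mu f + 2%:E * sqwint E mu g)%E.
Proof.
move=> mf mg; rewrite -(sqwint_lincomb (ler0n _ 2) (ler0n _ 2) mf mg).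
have mgN : cmeasurable_fun E (fun z => - g z).
  by under eq_fun do rewrite -mulN1r; exact: cmeasurable_funZ.
have := @sqwint_lincomb 1 1 (fun z => f z + g z) (fun z => f z - g z) ler01 ler01
  (cmeasurable_funD mf mg) (cmeasurable_funD mf mgN).
rewrite !mul1e => <-; apply: eq_integral => z _.
by rewrite !mul1r normc_parallelogram.
Qed.

Lemma sqwint_sumZ (s : R) f g : 0 < s ->
  cmeasurable_fun E f -> cmeasurable_fun E g ->
  (sqwint E mu (fun z => f z + g z)%R <=
   (1 + s)%:E * sqwint E mu f + (1 + s^-1)%:E * sqwint E mu g)%E.
Proof.
move=> s0 mf mg; have s1 : 0 < s^-1 by rewrite invr_gt0.
have s2 : 0 <= 1 + s by lra.
have s3 : 0 <= 1 + s^-1 by lra.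
rewrite -(sqwint_lincomb s2 s3 mf mg); apply: (ge0_le_integral dV mE).
- by move=> z Ez; rewrite lee_fin mulr_ge0 ?sqr_ge0// ltW// wmu.2.
- exact: sqwint_measurable (cmeasurable_funD mf mg).
- apply/measurable_EFinP/measurable_funM; last exact: wmu.1.
  have mc (r : R) h : cmeasurable_fun E h ->
      measurable_fun E (fun z => r * normc (h z) ^+ 2).
    move=> mh; apply: measurable_funM; last exact: cmeasurable_normc2.
    exact: measurable_cst.
  exact: measurable_funD (mc _ _ mf) (mc _ _ mg).
- move=> z Ez; rewrite lee_fin ler_wpM2r ?normc_sumZ//.
  exact/ltW/wmu.2.
Qed.

Lemma sqwintZ (c : R[i]) f : cmeasurable_fun E f ->
  sqwint E mu (fun z => c * f z) = ((normc c ^+ 2)%:E * sqwint E mu f)%E.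
Proof.
move=> mf; rewrite -[RHS]adde0 -[X in (_ + X)%E](mul0e (sqwint E mu f)).
rewrite -(sqwint_lincomb (sqr_ge0 _) (lexx 0) mf mf); apply: eq_integral => z _.
by rewrite ComplexField.Normc.normcM exprMn mul0r addr0.
Qed.

Lemma L2Z (c : R[i]) f : L2 E mu f -> L2 E mu (fun z => c * f z).
Proof.
move=> L2f; split; first exact: cmeasurable_funZ L2f.1.
by rewrite (sqwintZ _ L2f.1) (sqwint_wnorm L2f) -EFinM ltry.
Qed.

Lemma L2D f g : L2 E mu f -> L2 E mu g -> L2 E mu (fun z => f z + g z).
Proof.
move=> L2f L2g; split; first exact: cmeasurable_funD L2f.1 L2g.1.
apply: (le_lt_trans (sqwint_sumZ ltr01 L2f.1 L2g.1)).
by rewrite (sqwint_wnorm L2f) (sqwint_wnorm L2g) -!EFinM -EFinD ltry.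
Qed.

Lemma L2N g : L2 E mu g -> L2 E mu (fun z => - g z).
Proof. by under eq_fun do rewrite -mulN1r; exact: L2Z. Qed.

Lemma L2B f g : L2 E mu f -> L2 E mu g -> L2 E mu (fun z => f z - g z).
Proof. by move=> L2f L2g; exact: L2D L2f (L2N L2g). Qed.

Lemma wnormZ (c : R[i]) f : L2 E mu f ->
  wnorm E mu (fun z => c * f z) = normc c * wnorm E mu f.
Proof.
move=> L2f; rewrite /wnorm (sqwintZ _ L2f.1) (sqwint_wnorm L2f)/=.
rewrite sqrtrM ?sqr_ge0// !sqrtr_sqr !ger0_norm ?normc_ge0//.
exact: wnorm_ge0.
Qed.

Lemma wnormBC f g : wnorm E mu (fun z => f z - g z) = wnorm E mu (fun z => g z - f z).
Proof.
congr (Num.sqrt (fine _)); apply: eq_integral => z _.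
by rewrite normcB_sym.
Qed.

Lemma wnorm_parallelogram f g : L2 E mu f -> L2 E mu g ->
  wnorm E mu (fun z => f z + g z) ^+ 2 + wnorm E mu (fun z => f z - g z) ^+ 2 =
  2 * wnorm E mu f ^+ 2 + 2 * wnorm E mu g ^+ 2.
Proof.
move=> L2f L2g; have := sqwint_parallelogram L2f.1 L2g.1.
rewrite (sqwint_wnorm L2f) (sqwint_wnorm L2g) (sqwint_wnorm (L2D L2f L2g)).
by rewrite (sqwint_wnorm (L2B L2f L2g)) -!EFinM -!EFinD => -[].
Qed.

Lemma wnormD f g : L2 E mu f -> L2 E mu g ->
  wnorm E mu (fun z => f z + g z) <= wnorm E mu f + wnorm E mu g.
Proof.
move=> L2f L2g; set N := wnorm _ _ _.
have := wnorm_ge0 f; have := wnorm_ge0 g.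
move fA : (wnorm E mu f) => A; move gB : (wnorm E mu g) => B B0 A0.
have key (s : R) : 0 < s -> N ^+ 2 <= (1 + s) * A ^+ 2 + (1 + s^-1) * B ^+ 2.
  move=> s0; have := sqwint_sumZ s0 L2f.1 L2g.1.
  rewrite (sqwint_wnorm L2f) (sqwint_wnorm L2g) (sqwint_wnorm (L2D L2f L2g)).
  by rewrite fA gB -!EFinM -EFinD lee_fin.
rewrite -(@ler_pXn2r _ 2)// ?nnegrE ?addr_ge0 ?wnorm_ge0//.
apply/ler_addgt0Pr => e e0.
(* The optimal parameter is s = B / A. Shifting both terms by d > 0 keeps it defined and positive
   when A or B is 0, at a cost d (A + B) <= e. *)
pose d := e / (A + B + 1).
have d0 : 0 < d by rewrite divr_gt0//; lra.
have s0 : 0 < (B + d) / (A + d) by rewrite divr_gt0//; lra.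
apply: le_trans (key _ s0) _; rewrite invf_div.
have h1 : (B + d) / (A + d) * A ^+ 2 <= (B + d) * A.
  rewrite -mulrA ler_wpM2l//; first lra.
  rewrite mulrC ler_pdivrMr; last lra.
  by rewrite expr2 ler_wpM2l//; lra.
have h2 : (A + d) / (B + d) * B ^+ 2 <= (A + d) * B.
  rewrite -mulrA ler_wpM2l//; first lra.
  rewrite mulrC ler_pdivrMr; last lra.
  by rewrite expr2 ler_wpM2l//; lra.
have h3 : d * (A + B) <= e.
  have -> : e = d * (A + B + 1) by rewrite /d divfK//; apply: lt0r_neq0; lra.
  by rewrite ler_pM2l//; lra.
by rewrite !mulrDl !mul1r sqrrD; move: h1 h2 h3; rewrite !mulrDl !mulrDr; lra.
Qed.

End weighted_norm.

(** * Completeness of weighted spaces of holomorphic functions *)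

Lemma real_cauchy_cvg {R : realType} (u : nat -> R) :
  (forall e, 0 < e -> exists N, forall i j, (N <= i)%N -> (N <= j)%N ->
     `|u i - u j| <= e) -> cvgn u.
Proof.
move=> cu; apply/cauchy_cvgP/cauchy_exP => e e0.
have [N Nu] := cu (e / 2) (divr_gt0 e0 (ltr0n _ 2)).
exists (u N); exists N => // j /= Nj; rewrite -ball_normE/=.
by apply: le_lt_trans (Nu N j (leqnn N) Nj) _; lra.
Qed.

Section weighted_norm_limits.
Context {R : realType} {n : nat}.
Local Notation C := (Cn R n).
Local Notation dV := (lebesgue_Cn R n).
Local Notation normc := ComplexField.Normc.normc.
Variables (E : set C) (mu : C -> R).
Hypotheses (mE : measurable E) (wmu : weight E mu).

Lemma limn_einf_le (u : nat -> \bar R) (c : \bar R) :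
  (forall k, u k <= c)%E -> (limn_einf u <= c)%E.
Proof.
move=> uc; rewrite limn_einf_lim; apply: lime_le; first exact: is_cvg_einfs.
apply: nearW => k; apply: le_trans (uc k); apply: ereal_inf_lbound.
by exists k => /=.
Qed.

(** Fatou's lemma: the squared norm is lower semicontinuous along pointwise limits. *)
Lemma sqwint_lim_le (f : nat -> C -> R[i]) (g : C -> R[i]) (c : \bar R) :
  (forall k, cmeasurable_fun E (f k)) ->
  (forall z, E z -> complex.Re (f k z) @[k --> \oo] --> complex.Re (g z)) ->
  (forall z, E z -> complex.Im (f k z) @[k --> \oo] --> complex.Im (g z)) ->
  (forall k, sqwint E mu (f k) <= c)%E -> (sqwint E mu g <= c)%E.
Proof.
move=> mf fgr fgi fc.
pose h k z := (normc (f k z) ^+ 2 * mu z)%:E.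
have -> : sqwint E mu g = (\int[dV]_(z in E) limn_einf (h ^~ z))%E.
  apply: eq_integral => z /[!inE] Ez.
  have hz : h ^~ z @ \oo --> (normc (g z) ^+ 2 * mu z)%:E.
    apply/cvg_EFin; first by apply: nearW => k.
    apply: cvgM; last exact: cvg_cst.
    under eq_fun do rewrite sqr_normc_ReIm !expr2.
    by rewrite sqr_normc_ReIm !expr2; apply: cvgD; apply: cvgM;
      [exact: fgr|exact: fgr|exact: fgi|exact: fgi].
  by rewrite is_cvg_limn_einfE; [rewrite (cvg_lim _ hz)|apply/cvg_ex; eexists; exact: hz].
apply: (@le_trans _ _ (limn_einf (fun k => sqwint E mu (f k)))).
  apply: (fatou dV mE) => [k|k z Ez]; first exact: sqwint_measurable.
  by rewrite lee_fin mulr_ge0 ?sqr_ge0// ltW// wmu.2.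
exact: limn_einf_le.
Qed.

Lemma ae_eq_sqwint f g : cmeasurable_fun E f -> cmeasurable_fun E g ->
  {ae dV, forall z, E z -> f z = g z} -> sqwint E mu f = sqwint E mu g.
Proof.
move=> mf mg [N [mN N0 fgN]].
rewrite /sqwint; apply: (@ae_eq_integral _ _ _ dV E _ _ mE
  (sqwint_measurable wmu mf) (sqwint_measurable wmu mg)).
exists N; split => // z fgz; apply: fgN => /= fg; apply: fgz => Ez.
by rewrite fg.
Qed.

End weighted_norm_limits.

Section holomorphic_L2.
Context {R : realType} {n : nat}.
Local Notation C := (Cn R n).
Local Notation dV := (lebesgue_Cn R n).
Local Notation normc := ComplexField.Normc.normc.
Variables (W : set C) (mu : C -> R).
Hypotheses (mW : measurable W) (wmu : weight W mu).
Implicit Types f g : C -> R[i].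

Lemma holomorphic_onD f g : holomorphic_on W f -> holomorphic_on W g ->
  holomorphic_on W (fun z => f z + g z).
Proof.
by move=> hf hg z Wz; exact: differentiableD (hf z Wz) (hg z Wz).
Qed.

Lemma holomorphic_onZ (c : R[i]) f : holomorphic_on W f ->
  holomorphic_on W (fun z => c * f z).
Proof. by move=> hf z Wz; exact: differentiableZ (hf z Wz). Qed.

Lemma L2HD f g : L2H W mu f -> L2H W mu g -> L2H W mu (fun z => f z + g z).
Proof.
move=> [L2f hf] [L2g hg]; split; first exact: L2D.
exact: holomorphic_onD.
Qed.

Lemma L2HZ (c : R[i]) f : L2H W mu f -> L2H W mu (fun z => c * f z).
Proof. by move=> [L2f hf]; split; [exact: L2Z|exact: holomorphic_onZ]. Qed.

Lemma L2HB f g : L2H W mu f -> L2H W mu g -> L2H W mu (fun z => f z - g z).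
Proof.
move=> L2f L2g; apply: L2HD L2f _.
by under eq_fun do rewrite -mulN1r; exact: L2HZ.
Qed.

Lemma L2H0 : L2H W mu (fun=> 0).
Proof.
have m0 : cmeasurable_fun W (fun=> 0 : R[i]) by split; exact: measurable_cst.
split; last by move=> z _; exact: differentiable_cst.
split=> //; rewrite (_ : (fun=> 0) = fun z => 0 * 0); last first.
  by apply/funext => z; rewrite mulr0.
by rewrite (sqwintZ mW wmu _ m0) ComplexField.Normc.normc0 expr0n mul0e ltry.
Qed.

End holomorphic_L2.

Section admissible_weight.
Context {R : realType} {n : nat}.
Local Notation C := (Cn R n).
Local Notation dV := (lebesgue_Cn R n).
Local Notation normc := ComplexField.Normc.normc.
Variables (W : set C) (mu : C -> R).
Hypothesis admmu : admissible W mu.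
Implicit Types f g : C -> R[i].

Lemma admissible_weight : weight W mu. Proof. by case: admmu. Qed.

Lemma admissible_measurable : measurable W.
Proof. by case: admmu => oW *; exact: open_measurable_Cn. Qed.

Let wmu := admissible_weight.
Let mW := admissible_measurable.

Lemma eval_bounded t : W t ->
  exists2 c : R, 0 < c & forall f, L2H W mu f -> normc (f t) <= c * wnorm W mu f.
Proof.
move=> Wt; have [_ _ _ /(_ t Wt) ect] := admmu.
have [d d0 dP] := ect _ (L2H0 mW wmu) 1 ltr01.
exists (2 / d); first by rewrite divr_gt0.
move=> f L2f; rewrite mulrAC ler_pdivlMr//.
apply/ler_addgt0Pr => e e0.
have N0 := wnorm_ge0 W mu f.
have Ne : 0 < wnorm W mu f + e / 2 by lra.
(* Rescales f into the ball of radius d where continuity at 0 applies. The factor 2 makes the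
   inequality strict, and [e / 2] avoids division by 0 when f has norm 0. *)
pose s := d / (2 * (wnorm W mu f + e / 2)).
have s0 : 0 < s by rewrite divr_gt0 ?mulr_gt0.
have sd : s * wnorm W mu f < d.
  rewrite /s mulrAC ltr_pdivrMr ?mulr_gt0// ltr_pM2l//; lra.
have := dP _ (L2HZ mW wmu s%:C%C L2f).
rewrite (@eq_wnorm _ _ _ _ _ (fun z => s%:C%C * f z)); last first.
  by move=> z _; rewrite subr0.
rewrite (wnormZ mW wmu _ L2f.1) subr0 ComplexField.Normc.normcM normc_real.
rewrite (gtr0_norm s0) => /(_ sd).
rewrite /s mulrAC ltr_pdivrMr ?mulr_gt0// mul1r mulrC => /ltW.
by move/le_trans; apply; lra.
Qed.

(** Closedness applies only once an L^2 limit is known. Bounded evaluations make the sequence Cauchy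
    at each point, Fatou places the pointwise limit g in L^2, and [L2H_closed] replaces g by an
    almost everywhere equal holomorphic h. *)
Lemma L2H_complete (f : nat -> C -> R[i]) : (forall k, L2H W mu (f k)) ->
  (forall e, 0 < e -> exists N, forall i j, (N <= i)%N -> (N <= j)%N ->
     wnorm W mu (fun z => f i z - f j z) <= e) ->
  exists2 h, L2H W mu h & forall e, 0 < e -> exists N, forall k, (N <= k)%N ->
     wnorm W mu (fun z => f k z - h z) <= e.
Proof.
move=> L2f cf.
have cauchy_at t : W t -> forall e, 0 < e -> exists N, forall i j,
    (N <= i)%N -> (N <= j)%N -> normc (f i t - f j t) <= e.
  move=> Wt e e0; have [c c0 cP] := eval_bounded Wt.
  have [N NP] := cf (e / c) (divr_gt0 e0 c0); exists N => i j Ni Nj.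
  apply: le_trans (cP _ (L2HB mW wmu (L2f i) (L2f j))) _.
  by rewrite mulrC -ler_pdivlMr// NP.
pose g z := Complex (limn (fun k => complex.Re (f k z)))
                    (limn (fun k => complex.Im (f k z))).
have cvgRe t : W t -> complex.Re (f k t) @[k --> \oo] --> complex.Re (g t).
  move=> Wt; apply: real_cauchy_cvg => e /(cauchy_at t Wt)[N NP].
  exists N => i j Ni Nj; rewrite -raddfB.
  exact: le_trans (Re_le_normc _) (NP _ _ Ni Nj).
have cvgIm t : W t -> complex.Im (f k t) @[k --> \oo] --> complex.Im (g t).
  move=> Wt; apply: real_cauchy_cvg => e /(cauchy_at t Wt)[N NP].
  exists N => i j Ni Nj; rewrite -raddfB.
  exact: le_trans (Im_le_normc _) (NP _ _ Ni Nj).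
have mg : cmeasurable_fun W g.
  split.
    by apply: (@measurable_fun_cvg _ _ _ _ (fun k z => complex.Re (f k z)));
      [move=> k; exact: (L2f k).1.1.1|exact: cvgRe].
  by apply: (@measurable_fun_cvg _ _ _ _ (fun k z => complex.Im (f k z)));
    [move=> k; exact: (L2f k).1.1.2|exact: cvgIm].
have mfg k : cmeasurable_fun W (fun z => f k z - g z).
  apply: cmeasurable_funD; first exact: (L2f k).1.1.
  by under eq_fun do rewrite -mulN1r; exact: cmeasurable_funZ.
have fg_small e : 0 < e -> exists N, forall k, (N <= k)%N ->
    (sqwint W mu (fun z => f k z - g z)%R <= (e ^+ 2)%:E)%E.
  move=> e0; have [N NP] := cf e e0; exists N => k Nk.
  (* Here k is fixed and j tends to infinity; the shift by N makes the Cauchy bound hold for every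
     j. *)
  apply: (@sqwint_lim_le _ _ _ _ mW wmu (fun j z => f k z - f (j + N)%N z)).
  - by move=> j; exact: (L2HB mW wmu (L2f k) (L2f _)).1.1.
  - move=> z Wz; rewrite raddfB/=; under eq_fun do rewrite raddfB/=.
    apply: cvgB; first exact: cvg_cst.
    by rewrite (cvg_shiftn N (fun j => complex.Re (f j z))); exact: cvgRe.
  - move=> z Wz; rewrite raddfB/=; under eq_fun do rewrite raddfB/=.
    apply: cvgB; first exact: cvg_cst.
    by rewrite (cvg_shiftn N (fun j => complex.Im (f j z))); exact: cvgIm.
  - move=> j; rewrite (sqwint_wnorm wmu (L2HB mW wmu (L2f k) (L2f _)).1).
    rewrite lee_fin ler_pXn2r ?nnegrE ?wnorm_ge0 ?(ltW e0)//.
    by apply: NP => //; exact: leq_addl.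
have L2fg : exists k, L2 W mu (fun z => f k z - g z).
  have [N NP] := fg_small 1 ltr01; exists N; split=> //.
  exact: le_lt_trans (NP N (leqnn N)) (ltry _).
have L2g : L2 W mu g.
  have [k L2k] := L2fg.
  rewrite (_ : g = fun z => f k z - (f k z - g z)); last first.
    by apply/funext => z; rewrite opprB addrC subrK.
  exact: (L2B mW wmu (L2f k).1 L2k).
have wfg e : 0 < e -> exists N, forall k, (N <= k)%N ->
    wnorm W mu (fun z => f k z - g z) <= e.
  move=> e0; have [N NP] := fg_small e e0; exists N => k Nk.
  have := NP k Nk; rewrite (sqwint_wnorm wmu (L2B mW wmu (L2f k).1 L2g)) lee_fin.
  by rewrite ler_pXn2r ?nnegrE ?wnorm_ge0 ?(ltW e0).
have [_ _ clo _] := admmu.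
have [|h L2h hg] := clo f g L2f L2g.
  apply/cvgrPdist_le => e e0; have [N NP] := wfg e e0.
  exists N => // k /= Nk; rewrite sub0r normrN ger0_norm ?wnorm_ge0//.
  exact: NP.
exists h => // e /wfg[N NP]; exists N => k Nk.
rewrite (_ : wnorm _ _ _ = wnorm W mu (fun z => f k z - g z)); first exact: NP.
have fh : {ae dV, forall z, W z -> f k z - h z = f k z - g z}.
  by apply: filterS hg => z hgz Wz; rewrite hgz.
congr (Num.sqrt (fine _)).
exact: (ae_eq_sqwint mW wmu (L2HB mW wmu (L2f k) L2h).1.1 (mfg k) fh).
Qed.

End admissible_weight.

(** * Minimizers and the Bergman kernel *)

Section bergman_kernel.
Context {R : realType} {n : nat}.
Local Notation C := (Cn R n).
Local Notation dV := (lebesgue_Cn R n).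
Local Notation normc := ComplexField.Normc.normc.
Variables (W : set C) (mu : C -> R).
Hypothesis admmu : admissible W mu.
Implicit Types f g : C -> R[i].

Let wmu := admissible_weight admmu.
Let mW := admissible_measurable admmu.
Local Notation nrm := (wnorm W mu).

Lemma minimizer_exists t : W t -> norm1_at W mu t !=set0 ->
  exists h, norm1_at W mu t h /\ forall g, norm1_at W mu t g -> nrm h <= nrm g.
Proof.
move=> Wt [f0 f01].
pose S := [set nrm g | g in norm1_at W mu t].
have infS : has_inf S.
  split; first by exists (nrm f0); exists f0.
  by exists 0 => _ [g _ <-]; exact: wnorm_ge0.
pose I := inf S.
have I_le g : norm1_at W mu t g -> I <= nrm g.
  by move=> g1; apply: inf_lbound; [exact: infS.2|exists g].
have I0 : 0 <= I by apply: lb_le_inf; [exact: infS.1|move=> _ [g _ <-]; exact: wnorm_ge0].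
have [f fP] : {f : nat -> C -> R[i] &
    forall k, norm1_at W mu t (f k) /\ nrm (f k) < I + k.+1%:R^-1}.
  apply: (@choice _ _ (fun k f => norm1_at W mu t f /\ nrm f < I + k.+1%:R^-1)) => k.
  by have [|_ [g g1 <-] gI] := @inf_adherent _ S k.+1%:R^-1 _ infS;
    [rewrite invr_gt0|exists g].
have L2f k : L2H W mu (f k) by have [[]] := fP k.
have ft k : f k t = 1 by have [[]] := fP k.
have fI_small e : 0 < e -> exists N, forall k, (N <= k)%N -> nrm (f k) <= I + e.
  move=> e0; have [N _ NP] := near_infty_natSinv_lt (PosNum e0).
  exists N => k Nk; apply: le_trans (ltW (fP k).2) _.
  by rewrite lerD2l ltW// NP.
have mid i j : 2 * I <= nrm (fun z => f i z + f j z).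
  have := I_le (fun z => (2^-1)%:C%C * (f i z + f j z)).
  rewrite (wnormZ mW wmu _ (L2HD mW wmu (L2f i) (L2f j)).1) normc_real.
  rewrite ger0_norm ?invr_ge0// mulrC ler_pdivlMr// mulrC; apply; split.
    exact: (L2HZ mW wmu _ (L2HD mW wmu (L2f i) (L2f j))).
  by rewrite !ft -[1 + 1]/(1 *+ 2) -(rmorph_nat (real_complex R)) -rmorphM mulVf.
have [e|h L2h fh] := L2H_complete admmu L2f.
  (* If both norms are at most I + d, the parallelogram law and [mid] bound the squared distance by
     4 (I + d)^2 - 4 I^2 = 8 I d + 4 d^2, which is at most d (8 I + 4) as d <= 1. *)
  move=> e0; pose d := Num.min 1 (e ^+ 2 / (8 * I + 4)).
  have I4 : 0 < 8 * I + 4 by lra.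
  have d0 : 0 < d by rewrite lt_min ltr01 divr_gt0 ?exprn_gt0.
  have d1 : d <= 1 by rewrite ge_min lexx.
  have dI : d * (8 * I + 4) <= e ^+ 2 by rewrite -ler_pdivlMr// ge_min lexx orbT.
  move: d d0 d1 dI => d d0 d1 dI.
  have [N NP] := fI_small d d0; exists N => i j Ni Nj.
  rewrite -(@ler_pXn2r _ 2)// ?nnegrE ?wnorm_ge0 ?(ltW e0)//.
  have := wnorm_parallelogram mW wmu (L2f i).1 (L2f j).1.
  have := mid i j; have := NP i Ni; have := NP j Nj.
  have := wnorm_ge0 W mu (f i); have := wnorm_ge0 W mu (f j).
  move: (nrm (f i)) (nrm (f j)) (nrm (fun z => f i z + f j z))
    (nrm (fun z => f i z - f j z)).
  move=> a b c s b0 a0 bI aI cI.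
  move: I I0 I_le I4 dI bI aI cI {infS fP fI_small mid NP} => I I0 _ I4 dI bI aI cI.
  have : a ^+ 2 <= (I + d) ^+ 2 by rewrite ler_pXn2r ?nnegrE//; lra.
  have : b ^+ 2 <= (I + d) ^+ 2 by rewrite ler_pXn2r ?nnegrE//; lra.
  have : (2 * I) ^+ 2 <= c ^+ 2 by rewrite ler_pXn2r ?nnegrE//; lra.
  have : d ^+ 2 <= d by rewrite expr2 ler_piMl//; lra.
  rewrite sqrrD exprMn; move: dI; rewrite mulrDr mulrCA (mulrC d I); lra.
exists h.
have hI : nrm h <= I.
  apply/ler_addgt0Pr => e e0; have e20 : 0 < e / 2 by rewrite divr_gt0.
  have [N1 N1P] := fI_small _ e20; have [N2 N2P] := fh _ e20.
  have /N1P le1 := leq_maxl N1 N2; have /N2P le2 := leq_maxr N1 N2.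
  move: (maxn N1 N2) le1 le2 => k le1 le2.
  rewrite (@eq_wnorm _ _ _ _ _ (fun z => f k z + (h z - f k z))); last first.
    by move=> z _; rewrite addrC subrK.
  apply: le_trans (wnormD mW wmu (L2f k).1 (L2HB mW wmu L2h (L2f k)).1) _.
  by rewrite (wnormBC _ _ h); lra.
split; last by move=> g /I_le; exact: le_trans.
(* The constraint of value 1 at t passes to the norm limit because evaluation at t is bounded. *)
split=> //; have [c c0 cP] := eval_bounded admmu Wt.
apply/eqP; rewrite eq_sym -subr_eq0; apply/eqP/ComplexField.Normc.eq0_normc/eqP.
rewrite eq_le normc_ge0 andbT; apply/ler_addgt0Pr => e e0; rewrite add0r.
have [N /(_ N (leqnn N)) NP] := fh (e / c) (divr_gt0 e0 c0).
have := cP _ (L2HB mW wmu (L2f N) L2h); rewrite ft => /le_trans; apply.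
by rewrite mulrC -ler_pdivlMr.
Qed.

(** At points of the domain the diagonal value is a nonnegative real, so the real part loses
    nothing; it is the squared norm of the evaluation functional at t. *)
Definition bergman_diag (V : set C) (nu : C -> R) t : R :=
  complex.Re (bergman_kernel V nu t t).

(** The interface to the kernel, after which minimizers no longer appear. The last clause is
    minimality tested against f / f(t); if the class of functions with value 1 at t is empty, every
    f vanishes at t and all clauses hold with kernel 0. *)
Lemma bergman_kernelP t : W t ->
  [/\ L2H W mu (fun z => bergman_kernel W mu z t),
      bergman_kernel W mu t t = (bergman_diag W mu t)%:C%C,
      0 <= bergman_diag W mu t,
      nrm (fun z => bergman_kernel W mu z t) ^+ 2 = bergman_diag W mu t &
      forall f, L2H W mu f ->
        normc (f t) ^+ 2 <= bergman_diag W mu t * nrm f ^+ 2].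
Proof.
move=> Wt; rewrite /bergman_diag /bergman_kernel.
case: asboolP => [ne|emp]; last first.
  split; [exact: L2H0|by []|exact: lexx| |].
    rewrite (@eq_wnorm _ _ _ _ _ (fun=> 0 * 0)); last by move=> z _; rewrite mul0r.
    rewrite (wnormZ mW wmu 0 (L2H0 mW wmu).1).
    by rewrite ComplexField.Normc.normc0 mul0r expr0n.
  move=> f L2f; rewrite /= mul0r.
  have [->|ft0] := eqVneq (f t) 0; first by rewrite ComplexField.Normc.normc0 expr0n.
  exfalso; apply: emp; exists (fun z => (f t)^-1 * f z); split; last exact: mulVf.
  exact: L2HZ.
have [[L2p p1] pmin] := xgetPex (fun=> 0) (minimizer_exists Wt ne).
rewrite -/(minimizer W mu t) in L2p p1 pmin *.
move: (minimizer W mu t) L2p p1 pmin => p L2p p1 pmin.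
have M0 : 0 < nrm p.
  rewrite lt_neqAle wnorm_ge0 andbT; apply/eqP => M0.
  have [c c0 /(_ _ L2p)] := eval_bounded admmu Wt.
  by rewrite p1 ComplexField.Normc.normc1 -M0 mulr0 ler10.
have M2 : 0 < nrm p ^+ 2 by rewrite exprn_gt0.
have KE : (fun z => p z / (nrm p ^+ 2)%:C%C) = fun z => (nrm p ^- 2)%:C%C * p z.
  by apply/funext => z; rewrite mulrC fmorphV.
rewrite KE p1 mul1r.
have -> : ((nrm p ^+ 2)%:C%C)^-1 = (nrm p ^- 2)%:C%C by rewrite fmorphV.
split.
- exact: L2HZ.
- by [].
- by rewrite /= invr_ge0 ltW.
- rewrite /= (wnormZ mW wmu _ L2p.1) normc_real ger0_norm ?invr_ge0 ?(ltW M2)//.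
  by rewrite exprMn expr2 -mulrA mulVf ?mulr1// gt_eqF.
- move=> f L2f /=; have [->|ft0] := eqVneq (f t) 0.
    by rewrite ComplexField.Normc.normc0 expr0n mulr_ge0 ?invr_ge0 ?sqr_ge0.
  have := pmin (fun z => (f t)^-1 * f z) (conj (L2HZ mW wmu _ L2f) (mulVf ft0)).
  rewrite (wnormZ mW wmu _ L2f.1) ComplexField.Normc.normcV mulrC.
  have fn0 : 0 < normc (f t).
    rewrite lt_neqAle normc_ge0 andbT eq_sym; apply: contra ft0.
    by move=> /eqP/ComplexField.Normc.eq0_normc ->.
  rewrite ler_pdivlMr// => le1; rewrite mulrC ler_pdivlMr// -exprMn.
  by rewrite ler_pXn2r// ?nnegrE ?mulr_ge0 ?wnorm_ge0 ?normc_ge0// mulrC.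
Qed.

End bergman_kernel.

(** * Norm continuity of evaluations *)

Section differentiable_local.
Context {K : numFieldType} {V W : normedModType K}.
Implicit Types f g : V -> W.

(** Needed for the extension by 0, which agrees with the original function only on the open set. *)
Lemma near_eq_differentiable f g x : differentiable f x ->
  (\forall y \near x, f y = g y) -> differentiable g x.
Proof.
move=> df fg; have fgx : f x = g x by exact: nbhs_singleton fg.
have [dc dfE] := (diff_locallyP x f).1 df.
have dgE : g \o shift x = cst (g x) + 'd f x +o_ 0 id.
  apply/eqaddoP => e e0; have /eqaddoP/(_ e e0) fo := dfE.
  have fg0 : \forall y \near 0, f (y + x) = g (y + x).
    by move: fg; rewrite (near_shift 0) subr0.
  by apply: filterS2 fo fg0 => y; rewrite !fctE/= fgx => + <-.
by apply/diff_locallyP; rewrite (diff_unique dc dgE).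
Qed.

(** The little-o term with constant 1 is added to a bound of the differential. This supplies the
    pointwise boundedness hypothesis of the Banach-Steinhaus argument. *)
Lemma differentiable_lipschitz_at f x : differentiable f x ->
  exists2 L : K, 0 < L & \forall y \near x, `|f y - f x| <= L * `|y - x|.
Proof.
move=> /diff_locallyP[dc /eqaddoP/(_ 1 ltr01) fo].
have /linear_boundedP/pinfty_ex_gt0[L L0 dL] :
  bounded_near ('d f x) (nbhs 0) by apply: continuous_linear_bounded; exact: dc.
exists (L + 1); first by rewrite addr_gt0.
rewrite (near_shift 0) subr0; apply: filterS fo => y; rewrite !fctE/= => fo.
rewrite addrK mulrDl -[f (y + x) - f x](subrK ('d f x y)) addrC.
by apply: le_trans (ler_normD _ _) _; rewrite lerD// -addrA -opprD.
Qed.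

End differentiable_local.

Section equicontinuity.
Context {R : realType} {n : nat}.
Local Notation C := (Cn R n).
Local Notation normc := ComplexField.Normc.normc.
Variables (W : set C) (mu : C -> R).
Hypothesis admmu : admissible W mu.
Implicit Types f g : C -> R[i].

Let wmu := admissible_weight admmu.
Let mW := admissible_measurable admmu.
Local Notation nrm := (wnorm W mu).

Definition rnorm (v : C) : R := complex.Re `|v|.

Lemma rnormE v : `|v| = (rnorm v)%:C%C.
Proof. by rewrite /rnorm RRe_real// ger0_real. Qed.

Lemma rnorm_ge0 v : 0 <= rnorm v.
Proof. by have := normr_ge0 v; rewrite rnormE lecR. Qed.

Lemma L2H_lipschitz_at f t : W t -> L2H W mu f ->
  exists2 L : R, 0 < L & \forall y \near t, normc (f y - f t) <= L * rnorm (y - t).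
Proof.
move=> Wt [_ hf]; have [L L0 fL] := differentiable_lipschitz_at (hf t Wt).
have LE : L = (complex.Re L)%:C%C by rewrite RRe_real// gtr0_real.
exists (complex.Re L); first by rewrite LE ltcR in L0.
apply: filterS fL => y.
by rewrite norm_normc rnormE {1}LE -rmorphM lecR.
Qed.

Lemma wnorm_dist_triangle f g h : L2H W mu f -> L2H W mu g -> L2H W mu h ->
  nrm (fun z => f z - h z) <= nrm (fun z => f z - g z) + nrm (fun z => g z - h z).
Proof.
move=> L2f L2g L2h.
rewrite (@eq_wnorm _ _ _ _ _ (fun z => (f z - g z) + (g z - h z))).
  exact: (wnormD mW wmu (L2HB mW wmu L2f L2g).1 (L2HB mW wmu L2g L2h).1).
by move=> z _; rewrite addrA subrK.
Qed.

(* One step of the gliding hump: if the evaluations are not continuous in norm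
   at t, then every ball contains a smaller one on which some difference
   quotient at t is large. *)
Lemma gliding_hump_step t (eps : R) (x : C -> R[i]) (r d : R) : W t -> 0 < eps ->
  ~ (\forall y \near t, forall f, L2H W mu f ->
       normc (f y - f t) <= eps * nrm f) ->
  L2H W mu x -> 0 < r -> 0 < d -> forall B : set C, nbhs t B -> forall b : R, 0 < b ->
  exists x' r' y, [/\ L2H W mu x', 0 < r' <= d,
    nrm (fun z => x' z - x z) + r' <= r, B y &
    forall f, L2H W mu f -> nrm (fun z => f z - x' z) <= r' ->
      0 < normc (f y - f t) /\ b * rnorm (y - t) <= normc (f y - f t)].
Proof.
move=> Wt eps0 noeq L2x r0 d0 B tB b b0.
(* A bump of norm r / 2 violating the bound eps has difference at least eps r / 2 = 4 a. A centre
   with difference at least 2 a is then found, and elements of the new ball lose at most a, which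
   leaves a > b |y - t|. *)
pose a := eps * r / 8.
have a0 : 0 < a by rewrite divr_gt0 ?mulr_gt0.
have oW : open W by case: admmu.
have [y [[By Wy yb] [f L2f fy]]] : exists y,
    [/\ B y, W y & b * rnorm (y - t) < a] /\
    exists2 f, L2H W mu f & eps * nrm f < normc (f y - f t).
  apply: contrapT => no; apply: noeq.
  have tb : \forall y \near t, b * rnorm (y - t) < a.
    apply/nbhs_normP; exists (a / b)%:C%C => /=; first by rewrite ltcR divr_gt0.
    move=> y /=; rewrite distrC rnormE ltcR => yt.
    by rewrite mulrC -ltr_pdivlMr.
  have tW : nbhs t W by exact: open_nbhs_nbhs.
  apply: filterS3 tB tW tb => y By Wy yb f L2f.
  by rewrite leNgt; apply/negP => fy; apply: no; exists y; split=> //; exists f.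
have [cy cy0 cyP] := eval_bounded admmu Wy.
have [ct ct0 ctP] := eval_bounded admmu Wt.
have diffP g : L2H W mu g -> normc (g y - g t) <= (cy + ct) * nrm g.
  move=> L2g; apply: le_trans (le_normcD _ _) _; rewrite normcN mulrDl.
  by rewrite lerD ?cyP ?ctP.
have f0 : 0 < nrm f.
  rewrite lt_neqAle wnorm_ge0 andbT; apply/eqP => f0.
  by have := diffP f L2f; rewrite -f0 mulr0 leNgt => /negP; apply;
    rewrite (le_lt_trans _ fy)// -f0 mulr0.
pose s := r / 2 / nrm f.
have s0 : 0 < s by rewrite divr_gt0 ?divr_gt0.
pose xi z := s%:C%C * f z.
have L2xi : L2H W mu xi by exact: L2HZ.
have nxi : nrm xi = r / 2.
  by rewrite (wnormZ mW wmu _ L2f.1) normc_real gtr0_norm// divfK// gt_eqF.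
have xiy : 4 * a <= normc (xi y - xi t).
  rewrite /xi -mulrBr ComplexField.Normc.normcM normc_real (gtr0_norm s0).
  have -> : 4 * a = s * (eps * nrm f) by rewrite /a /s; field; rewrite gt_eqF.
  by rewrite ler_pM2l// ltW.
(* Either x already has difference at least 2 a, or adding xi, whose difference is at least 4 a,
   leaves more than 2 a. *)
have [x' [L2x' x'x x'y]] : exists x', [/\ L2H W mu x',
    nrm (fun z => x' z - x z) <= r / 2 & 2 * a <= normc (x' y - x' t)].
  have [xy|xy] := leP (2 * a) (normc (x y - x t)).
    exists x; split=> //; rewrite (@eq_wnorm _ _ _ _ _ (fun=> 0 * 0)).
      rewrite (wnormZ mW wmu 0 (L2H0 mW wmu).1) ComplexField.Normc.normc0 mul0r.
      by rewrite divr_ge0// ltW.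
    by move=> z _; rewrite subrr mul0r.
  exists (fun z => x z + xi z); split; first exact: L2HD.
    rewrite (@eq_wnorm _ _ _ _ _ xi) ?nxi// => z _.
    by rewrite addrC addKr.
  have := le_normcD (x y + xi y - (x t + xi t)) (- (x y - x t)).
  rewrite normcN.
  have -> : x y + xi y - (x t + xi t) - (x y - x t) = xi y - xi t by ring.
  by lra.
have c0 : 0 < cy + ct by rewrite addr_gt0.
(* The three bounds serve in turn to make the radii shrink, to keep the new ball inside the old one,
   and to preserve the large difference on it. *)
exists x', (Num.min d (Num.min (r / 2) (a / (cy + ct)))), y.
set r' := Num.min _ _.
have r'd : r' <= d by rewrite ge_min lexx.
have r'r : r' <= r / 2 by rewrite !ge_min lexx orbT.
have r'a : r' * (cy + ct) <= a by rewrite -ler_pdivlMr// !ge_min lexx !orbT.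
split=> //.
- rewrite r'd andbT /r' !lt_min d0/=.
  by apply/andP; split; exact: divr_gt0.
- by lra.
- move=> g L2g gx'.
  have := diffP _ (L2HB mW wmu L2x' L2g); rewrite wnormBC => h1.
  have h2 := le_normcD (x' y - g y - (x' t - g t)) (g y - g t).
  have h3 : (cy + ct) * nrm (fun z => g z - x' z) <= a.
    by apply: le_trans r'a; rewrite mulrC ler_pM2r.
  have h4 : x' y - g y - (x' t - g t) + (g y - g t) = x' y - x' t by ring.
  by rewrite h4 in h2; split; lra.
Qed.

(* Banach-Steinhaus for the difference quotients of the evaluation functionals:
   pointwise boundedness is complex differentiability, so no Cauchy estimate
   is needed. *)
Lemma eval_equicontinuous t (eps : R) : W t -> 0 < eps ->
  \forall y \near t, forall f, L2H W mu f -> normc (f y - f t) <= eps * nrm f.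
Proof.
move=> Wt eps0; apply: contrapT => noeq.
pose B k := ball t (k.+1%:R^-1 : R)%:C%C.
pose ok (s : (C -> R[i]) * R) := L2H W mu s.1 /\ 0 < s.2.
(* A state is the centre and radius of a ball. Step k demands a difference quotient of at least k +
   1 at a point within 1 / (k + 1) of t, and a radius at most 1 / (k + 1). *)
have [F FP] : {F : nat * ((C -> R[i]) * R) -> ((C -> R[i]) * R) * C &
    forall ks, ok ks.2 -> let s := ks.2 in let s' := (F ks).1 in
    let y := (F ks).2 in
    [/\ ok s', s'.2 <= ks.1.+1%:R^-1, nrm (fun z => s'.1 z - s.1 z) + s'.2 <= s.2,
      B ks.1 y &
      forall f, L2H W mu f -> nrm (fun z => f z - s'.1 z) <= s'.2 ->
        0 < normc (f y - f t) /\ ks.1.+1%:R * rnorm (y - t) <= normc (f y - f t)]}.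
  apply: (@choice _ _ (fun (ks : nat * ((C -> R[i]) * R)) (s'y : ((C -> R[i]) * R) * C) =>
    ok ks.2 -> let s := ks.2 in let s' := s'y.1 in
    let y := s'y.2 in
    [/\ ok s', s'.2 <= ks.1.+1%:R^-1, nrm (fun z => s'.1 z - s.1 z) + s'.2 <= s.2,
      B ks.1 y &
      forall f, L2H W mu f -> nrm (fun z => f z - s'.1 z) <= s'.2 ->
        0 < normc (f y - f t) /\ ks.1.+1%:R * rnorm (y - t) <= normc (f y - f t)])).
  move=> [k [x r]]; have [[/= L2x r0]|] := pselect (ok (x, r)); last first.
    by move=> nok; exists ((x, r), t) => /= /nok.
  have k0 : 0 < k.+1%:R :> R by [].
  have k1 : 0 < k.+1%:R^-1 :> R by rewrite invr_gt0.
  have tB : nbhs t (B k).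
    by apply: nbhsx_ballx; rewrite ltcR.
  have [x' [r' [y [L2x' /andP[r'0 r'd] x'r By yP]]]] :=
    gliding_hump_step Wt eps0 noeq L2x r0 k1 tB k0.
  by exists ((x', r'), y).
pose s := fix s k := if k is k'.+1 then (F (k', s k')).1 else (fun=> 0, 1).
have ok_s k : ok (s k).
  elim: k => [|k IH]; first by split; [exact: L2H0|exact: ltr01].
  by have [] := FP (k, s k) IH.
have L2s k : L2H W mu (s k).1 by have [] := ok_s k.
(* Nesting of the balls, with the later radius kept on the left so that the induction closes through
   the triangle inequality. *)
have nest i m : nrm (fun z => (s (m + i)%N).1 z - (s i).1 z) + (s (m + i)%N).2 <= (s i).2.
  elim: m => [|m IH].
    rewrite add0n (@eq_wnorm _ _ _ _ _ (fun=> 0 * 0)); last first.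
      by move=> z _; rewrite subrr mul0r.
    rewrite (wnormZ mW wmu 0 (L2H0 mW wmu).1) ComplexField.Normc.normc0 mul0r.
    by rewrite add0r.
  have [_ _ + _ _] := FP ((m + i)%N, s (m + i)%N) (ok_s _); rewrite /=.
  have := wnorm_dist_triangle (L2s (m.+1 + i)%N) (L2s (m + i)%N) (L2s i).
  by rewrite addSn/=; lra.
have s0 k : 0 < (s k).2 by have [] := ok_s k.
have nest_le i k : (i <= k)%N -> nrm (fun z => (s k).1 z - (s i).1 z) <= (s i).2.
  by move=> ik; have := nest i (k - i)%N; rewrite subnK//; have := s0 k; lra.
have s_small e : 0 < e -> exists N, (s N).2 <= e.
  move=> e0; have [N _ /(_ N (leqnn N)) NP] := near_infty_natSinv_lt (PosNum e0).
  exists N.+1; have [_ + _ _ _] := FP (N, s N) (ok_s N) => /= /le_trans; apply.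
  exact: ltW.
have [e e0|h L2h sh] := L2H_complete admmu L2s.
  have [N NP] := s_small (e / 2) (divr_gt0 e0 (ltr0n _ 2)).
  exists N => i j Ni Nj.
  have := wnorm_dist_triangle (L2s i) (L2s N) (L2s j).
  rewrite [X in _ + X](wnormBC _ _ (s N).1).
  by have := nest_le _ _ Ni; have := nest_le _ _ Nj; lra.
have hs i : nrm (fun z => h z - (s i).1 z) <= (s i).2.
  apply/ler_addgt0Pr => e /sh[N NP].
  have := NP _ (leq_maxl N i); have := nest_le _ _ (leq_maxr N i).
  have := wnorm_dist_triangle L2h (L2s (maxn N i)) (L2s i).
  by rewrite (wnormBC _ _ h (s (maxn N i)).1); lra.
have [L L0 /nbhs_ballP[e e0 hL]] := L2H_lipschitz_at Wt L2h.
have eE : e = (complex.Re e)%:C%C by rewrite RRe_real// gtr0_real.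
have re0 : 0 < complex.Re e by move: e0; rewrite /= eE ltcR.
have [N1 _ N1P] := near_infty_natSinv_lt (PosNum re0).
have iL0 : 0 < L^-1 by rewrite invr_gt0.
have [N2 _ N2P] := near_infty_natSinv_lt (PosNum iL0).
pose k := maxn N1 N2.
have ke : k.+1%:R^-1 < complex.Re e by apply: (N1P k); exact: leq_maxl.
have kL : k.+1%:R^-1 < L^-1 by apply: (N2P k); exact: leq_maxr.
(* The limit h lies in the ball of index k + 1, so its difference at this y is at least (k + 1) |y -
   t|. As y is within e of t and k + 1 > L, this contradicts [hL]; positivity of the difference
   excludes y = t. *)
have [_ _ _ By /(_ h L2h (hs k.+1))[]] := FP (k, s k) (ok_s k).
move: (F (k, s k)).2 By => y /= By y0 yk.
have /hL /= : ball t e y.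
  apply: le_ball By; rewrite eE lecR; exact: ltW.
apply/negP; rewrite -ltNge.
have yt : 0 < rnorm (y - t).
  rewrite lt_neqAle rnorm_ge0 andbT eq_sym; apply/eqP => yt.
  have /subr0_eq yE : y - t = 0 by apply: normr0_eq0; rewrite rnormE yt.
  by move: y0; rewrite yE subrr ComplexField.Normc.normc0 ltxx.
apply: lt_le_trans yk; rewrite ltr_pM2r//.
by rewrite ltf_pV2 ?posrE in kL.
Qed.

End equicontinuity.

(** * Comparison of two kernels *)

Section kernel_comparison.
Context {R : realType} {n : nat}.
Local Notation C := (Cn R n).
Local Notation dV := (lebesgue_Cn R n).
Local Notation normc := ComplexField.Normc.normc.

Lemma cmeasurable_funS (A B : set C) (f : C -> R[i]) : measurable B ->
  A `<=` B -> cmeasurable_fun B f -> cmeasurable_fun A f.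
Proof. by move=> mB AB [fr fi]; split; exact: measurable_funS AB _. Qed.

Lemma le_sqwint (A B : set C) (mu nu : C -> R) (f : C -> R[i]) :
  measurable A -> measurable B -> weight A mu -> weight B nu -> A `<=` B ->
  (forall z, A z -> mu z <= nu z) -> cmeasurable_fun B f ->
  (sqwint A mu f <= sqwint B nu f)%E.
Proof.
move=> mA mB wmu wnu AB munu mf.
have mfA : cmeasurable_fun A f by exact: cmeasurable_funS AB mf.
have nu0 z : B z -> (0 <= (normc (f z) ^+ 2 * nu z)%:E)%E.
  by move=> Bz; rewrite lee_fin mulr_ge0 ?sqr_ge0// ltW// wnu.2.
have mnu := sqwint_measurable wnu mf.
apply: (@le_trans _ _ (sqwint A nu f)).
  apply: (ge0_le_integral dV mA).
  - by move=> z Az; rewrite lee_fin mulr_ge0 ?sqr_ge0// ltW// wmu.2.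
  - exact: sqwint_measurable.
  - exact: measurable_funS AB mnu.
  - by move=> z Az; rewrite lee_fin ler_wpM2l ?sqr_ge0// munu.
exact: (ge0_subset_integral dV mA mB mnu nu0 AB).
Qed.

Variables (D D' : set C) (mu mu' : C -> R).
Hypotheses (admmu : admissible D mu) (admmu' : admissible D' mu').
Hypotheses (DD' : D `<=` D') (mumu' : forall z, D z -> mu z <= mu' z).

Let wmu := admissible_weight admmu.
Let mD := admissible_measurable admmu.
Let wmu' := admissible_weight admmu'.
Let mD' := admissible_measurable admmu'.

Lemma L2H_restrict f : L2H D' mu' f ->
  L2H D mu f /\ wnorm D mu f ^+ 2 <= wnorm D' mu' f ^+ 2.
Proof.
move=> [L2f hf].
have le_f := le_sqwint mD mD' wmu wmu' DD' mumu' L2f.1.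
have L2f' : L2 D mu f.
  split; first exact: cmeasurable_funS DD' L2f.1.
  exact: le_lt_trans le_f L2f.2.
split; first by split=> // z /DD'; exact: hf.
by rewrite (sqwint_wnorm wmu L2f') (sqwint_wnorm wmu' L2f) lee_fin in le_f.
Qed.

(** Testing the extremal inequality on D with the kernel K' of D' gives k'^2 <= k |K'|^2 <= k k'. *)
Lemma bergman_diag_le t : D t -> bergman_diag D' mu' t <= bergman_diag D mu t.
Proof.
move=> Dt; have [L2K' K't k'0 nK' _] := bergman_kernelP admmu' (DD' Dt).
have [_ _ k0 _ eK] := bergman_kernelP admmu Dt.
have [L2K'D nK'D] := L2H_restrict L2K'.
have := eK _ L2K'D; rewrite K't normc_real (ger0_norm k'0).
move: nK'D; rewrite nK'.
move: (bergman_diag D mu t) (bergman_diag D' mu' t) k0 k'0 => k k' k0 k'0 qk' k'2.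
have [k'_gt0|k'_le0] := ltP 0 k'; last exact: le_trans k0.
rewrite -(@ler_pM2r _ k')// -expr2; apply: le_trans k'2 _.
by rewrite ler_wpM2l.
Qed.

(* AM-GM and the extremal property of v give
   |u + v|^2 >= (k + k')^2 / k >= 4 k'; conclude by the parallelogram law. *)
Lemma wnorm_dist_extremal (t : C) (u v : C -> R[i]) (k k' : R) :
  L2H D mu u -> L2H D mu v -> u t = k'%:C%C -> v t = k%:C%C ->
  wnorm D mu u ^+ 2 <= k' -> wnorm D mu v ^+ 2 = k -> 0 <= k' <= k ->
  (forall f, L2H D mu f -> normc (f t) ^+ 2 <= k * wnorm D mu f ^+ 2) ->
  wnorm D mu (fun z => u z - v z) ^+ 2 <= 2 * (k - k').
Proof.
move=> L2u L2v ut vt nu nv /andP[k'0 k'k] eK.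
have k0 : 0 <= k by lra.
have := wnorm_parallelogram mD wmu L2u.1 L2v.1.
have := eK _ (L2HD mD wmu L2u L2v); rewrite ut vt -rmorphD normc_real.
rewrite (ger0_norm (addr_ge0 k'0 k0)) nv; move: nu.
have := sqr_ge0 (wnorm D mu (fun z => u z + v z)).
move: (wnorm D mu (fun z => u z - v z) ^+ 2).
move: (wnorm D mu (fun z => u z + v z) ^+ 2) (wnorm D mu u ^+ 2).
move=> b a c b0 ak' kb bc; suff : 4 * k' <= b by lra.
have [kgt0|kle0] := ltP 0 k; last by have -> : k' = 0; lra.
rewrite -(@ler_pM2l _ k)//; apply: le_trans kb.
by have := sqr_ge0 (k - k'); rewrite !expr2; lra.
Qed.

(** Evaluation at z, of squared norm k(z), is applied to the difference of the two kernels at t,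
    seen as an element of the space on D. *)
Lemma bergman_kernel_dist z t : D z -> D t ->
  normc (bergman_kernel D' mu' z t - bergman_kernel D mu z t) ^+ 2 <=
  bergman_diag D mu z * (2 * (bergman_diag D mu t - bergman_diag D' mu' t)).
Proof.
move=> Dz Dt.
have [L2u ut k'0 nu _] := bergman_kernelP admmu' (DD' Dt).
have [L2v vt k0 nv eK] := bergman_kernelP admmu Dt.
have [_ _ kz0 _ ez] := bergman_kernelP admmu Dz.
have k'k := bergman_diag_le Dt.
have [L2uD nuD] := L2H_restrict L2u.
apply: le_trans (ez _ (L2HB mD wmu L2uD L2v)) _; apply: (ler_wpM2l kz0).
apply: (wnorm_dist_extremal L2uD L2v ut vt) nv _ eK; last by rewrite k'0.
by rewrite -nu.
Qed.

(** Applied to f = K(.,y) with w = f(y), v = f(t), a = |f| and b^2 = k(t): then a^2 = |f(y)| <=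
    |f(t)| + |f(y) - f(t)| <= (b + e) a. *)
Lemma extremal_growth (w v : R[i]) (a b e : R) : 0 <= a -> 0 <= b -> 0 <= e ->
  w = (a ^+ 2)%:C%C -> normc v ^+ 2 <= b ^+ 2 * a ^+ 2 ->
  normc (w - v) <= e * a -> a <= b + e.
Proof.
move=> a0 b0 e0 -> vb dv.
rewrite -exprMn ler_pXn2r ?nnegrE ?normc_ge0 ?mulr_ge0// in vb.
have := le_normcD v ((a ^+ 2)%:C%C - v).
rewrite addrC subrK normc_real ger0_norm ?sqr_ge0// => av.
have [a_gt0|a_le0] := ltP 0 a; last by lra.
rewrite -(@ler_pM2r _ a)// -expr2 mulrDl.
by apply: le_trans av _; exact: lerD.
Qed.

Lemma sqr_le_add (a b e eps : R) : 0 <= a -> 0 <= b -> 0 < e -> e <= 1 ->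
  e * (2 * b + 1) <= eps -> a <= b + e -> a ^+ 2 <= b ^+ 2 + eps.
Proof.
move=> a0 b0 e0 e1 eb ab; apply: (@le_trans _ _ ((b + e) ^+ 2)).
  by rewrite ler_pXn2r ?nnegrE//; lra.
have : e * e <= e by rewrite ler_piMl// ltW.
by rewrite !expr2; lra.
Qed.

(** The function tested, K(.,y), varies with y, so continuity of each single function is not enough:
    the equicontinuity bound must hold for all f at once. *)
Lemma bergman_diag_usc t (eps : R) : D t -> 0 < eps ->
  \forall y \near t, D y -> bergman_diag D mu y <= bergman_diag D mu t + eps.
Proof.
move=> Dt eps0; have [_ _ k0 _ eK] := bergman_kernelP admmu Dt.
pose b := Num.sqrt (bergman_diag D mu t).
have b0 : 0 <= b by exact: sqrtr_ge0.
have bE : bergman_diag D mu t = b ^+ 2 by rewrite sqr_sqrtr.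
have b1 : 0 < 2 * b + 1 by lra.
pose e := Num.min 1 (eps / (2 * b + 1)).
have e0 : 0 < e by rewrite lt_min ltr01 divr_gt0.
have e1 : e <= 1 by rewrite ge_min lexx.
have eb : e * (2 * b + 1) <= eps by rewrite -ler_pdivlMr// ge_min lexx orbT.
move: e e0 e1 eb => e e0 e1 eb.
apply: filterS (eval_equicontinuous admmu Dt e0) => y ye Dy.
have [L2f fy ky0 nf _] := bergman_kernelP admmu Dy.
have := ye _ L2f; have := eK _ L2f; rewrite bE => h1 h2.
rewrite -nf in fy; rewrite -nf.
have a0 := wnorm_ge0 D mu (fun z => bergman_kernel D mu z y).
have := extremal_growth a0 b0 (ltW e0) fy h1 h2.
exact: sqr_le_add.
Qed.

End kernel_comparison.

(** * Weights on the outer domains *)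

Section outer_weights.
Context {R : realType} {n : nat}.
Local Notation C := (Cn R n).
Local Notation dV := (lebesgue_Cn R n).
Local Notation normc := ComplexField.Normc.normc.
Variables (D : set C) (D_ : nat -> set C) (mu : C -> R) (mu_ : nat -> C -> R).
Variable p : nat.
Local Notation clD := (closure D).
Hypothesis oD_ : forall k, open (D_ k).
Hypothesis wmu_ : forall k, weight (D_ k) (mu_ k).
Hypothesis wmu : weight clD mu.
Hypothesis happrox : approximates_from_outside D_ D.
Hypothesis hp : \forall m \near \oo, D_ m `<=` D_ p.
Hypothesis ha : forall m z, (p <= m)%N -> D_ p z ->
  ext_weight_lim D D_ mu mu_ z <= ext_weight D_ mu_ m z <= mu_ p z.
Hypothesis hb : dV.-integrable (D_ p) (EFin \o mu_ p).
Hypothesis hc : {ae dV, forall z, D_ p z ->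
  ext_weight D_ mu_ k z @[k --> \oo] --> ext_weight_lim D D_ mu mu_ z}.

Let mD_ k : measurable (D_ k) := open_measurable_Cn (@oD_ k).
Let mclD : measurable clD := closed_measurable_Cn (@closed_closure _ D).

Lemma ext_weightE m z : D_ m z -> ext_weight D_ mu_ m z = mu_ m z.
Proof. by case: m => //= m Dz; rewrite asboolT. Qed.

Lemma ext_weight_limE z : clD z -> ext_weight_lim D D_ mu mu_ z = mu z.
Proof. by move=> Dz; rewrite /ext_weight_lim asboolT. Qed.

(** Positive part of mu_m 1_{D_m} - mu 1_{cl D}. Its integral against |F|^2 bounds how far the
    squared norm of F on D_m can exceed the one on the closure. *)
Definition excess_weight m z : R :=
  Num.max 0 ((if z \in D_ m then mu_ m z else 0) -
             (if z \in clD then mu z else 0)).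

Lemma excess_weight_ge0 m z : 0 <= excess_weight m z.
Proof. by rewrite le_max lexx. Qed.

Lemma measurable_fun_if0 (A B : set C) (f : C -> R) : measurable A ->
  measurable B -> measurable_fun A f ->
  measurable_fun B (fun z => if z \in A then f z else 0).
Proof.
move=> mA mB mf; apply: measurable_funTS.
exact: (measurable_restrictT f mA).1 mf.
Qed.

Lemma measurable_excess_weight (B : set C) m : measurable B ->
  measurable_fun B (excess_weight m).
Proof.
move=> mB; apply: measurable_maxr; first exact: measurable_cst.
apply: measurable_funB; apply: measurable_fun_if0 => //.
- exact: (wmu_ m).1.
- exact: wmu.1.
Qed.

Lemma excess_weight_le m z : (p <= m)%N -> D_ m `<=` D_ p -> D_ p z ->
  excess_weight m z <= mu_ p z.
Proof.
move=> pm Dmp Dpz; have mup0 := ltW ((wmu_ p).2 _ Dpz).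
have mu0 : 0 <= if z \in clD then mu z else 0.
  by case: ifPn => // /set_mem /wmu.2/ltW.
rewrite ge_max mup0 lerBlDr; case: ifPn => [/set_mem Dmz|_]; last exact: addr_ge0.
have /andP[_] := ha pm Dpz; rewrite (ext_weightE Dmz) => h.
by rewrite -[leLHS]addr0 lerD.
Qed.

(** A point off the closure eventually leaves D_m: take its complement as the open set G. On the
    closure the excess vanishes if z is not in D_m, and is otherwise bounded by the distance of the
    extended weight from mu, which tends to 0 almost everywhere. *)
Lemma excess_weight_cvg0 :
  {ae dV, forall z, D_ p z -> excess_weight m z @[m --> \oo] --> 0}.
Proof.
apply: filterS hc => z + Dpz => /(_ Dpz) zc.
have [Dz|nDz] := pselect (clD z); last first.
  have [_ /(_ (~` [set z]))] := happrox.
  case; first exact/closed_openC/accessible_closed_set1/hausdorff_accessible.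
    by move=> y Dy /= yz; apply: nDz; rewrite -yz.
  move=> N _ NP; apply: cvg_near_cst; exists N => // m /= Nm.
  have [_ _ Dmz] := NP m Nm; rewrite /excess_weight !memNset//.
    by rewrite subrr maxxx.
  by move=> Dz; exact: (Dmz z (subset_closure Dz)).
rewrite ext_weight_limE// in zc.
have zc0 : `|ext_weight D_ mu_ k z - mu z| @[k --> \oo] --> 0.
  rewrite -(normr0 R); apply: cvg_norm; rewrite -(subrr (mu z)).
  by apply: cvgB => //; exact: cvg_cst.
apply: (squeeze_cvgr _ (cvg_cst 0) zc0).
apply: nearW => m; rewrite excess_weight_ge0/= /excess_weight (mem_set Dz).
rewrite ge_max normr_ge0/=; case: ifPn => [/set_mem Dmz|_].
  by rewrite (ext_weightE Dmz) ler_norm.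
by rewrite sub0r (le_trans _ (normr_ge0 _))// oppr_le0 ltW// wmu.2.
Qed.

Lemma excess_weight_integral (e : R) : 0 < e ->
  \forall m \near \oo, (\int[dV]_(z in D_ p) (excess_weight m z)%:E <= e%:E)%E.
Proof.
move=> e0; have [N0 _ N0P] := hp; pose N := maxn N0 p.
have NP m : (N <= m)%N -> (p <= m)%N /\ D_ m `<=` D_ p.
  by rewrite geq_max => /andP[? ?]; split=> //; exact: N0P.
(* The shift makes the domination by mu_p valid for every index, as dominated convergence
   requires. *)
pose f m z := (excess_weight (m + N)%N z)%:E.
have mf m : measurable_fun (D_ p) (f m).
  by apply/measurable_EFinP; exact: measurable_excess_weight.
have fc : {ae dV, forall z, D_ p z -> f m z @[m --> \oo] --> (0 : \bar R)}.
  apply: filterS excess_weight_cvg0 => z + Dpz => /(_ Dpz) zc.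
  apply/cvg_EFin; first by apply: nearW.
  by rewrite (cvg_shiftn N (fun m => excess_weight m z)).
have fle : {ae dV, forall z m, D_ p z -> (`|f m z| <= (EFin \o mu_ p) z)%E}.
  apply: aeW => z m Dpz; rewrite gee0_abs ?lee_fin ?excess_weight_ge0//.
  by have [pm Dmp] := NP _ (leq_addl m N); exact: excess_weight_le.
have [_ _] := dominated_convergence (mD_ p) mf (measurable_cst 0%E) fc hb fle.
rewrite integral0 => /fine_cvgP[fin /cvgrPdist_le/(_ e e0) small].
have [N1 _ N1P] := filterI fin small.
exists (N1 + N)%N => // m /= N1m; have Nm : (N <= m)%N := leq_trans (leq_addl _ _) N1m.
have [|fint le_e] := N1P (m - N)%N; first by rewrite /= leq_subRL// addnC.
pose I k := (\int[dV]_(z in D_ p) f k z)%E.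
rewrite [X in (X <= _)%E](_ : _ = I (m - N)%N); last by rewrite /I /f subnK.
rewrite -(@fineK _ (I (m - N)%N) fint) lee_fin; apply: le_trans le_e.
by rewrite /= sub0r normrN ler_norm.
Qed.

Lemma closure_compact : compact clD.
Proof.
have [DD_ /(_ _ openT (@subsetT _ _))[N _ /(_ N (leqnn N))[_ cN _]]] := happrox.
exact: subclosed_compact (@closed_closure _ D) cN (closure_subset (DD_ N)).
Qed.

Lemma holomorphic_bounded_near (U : set C) (F : C -> R[i]) : open U ->
  clD `<=` U -> holomorphic_on U F ->
  exists M : R, 0 <= M /\ \forall m \near \oo, forall z, D_ m z ->
    U z /\ normc (F z) <= M.
Proof.
move=> oU clDU hF.
have cF z : U z -> {for z, continuous (fun w => normc (F w))}.
  move=> Uz; apply: continuous_comp; last exact: normc_continuous.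
  exact/differentiable_continuous/hF.
have : bounded_set ((fun w => normc (F w)) @` clD).
  apply/compact_bounded/continuous_compact; last exact: closure_compact.
  apply: continuous_in_subspaceT => z /set_mem Dz; exact/cF/clDU.
move=> /pinfty_ex_gt0[M M0 FM]; exists (M + 1); split; first by rewrite addr_ge0// ltW.
(* M bounds F only on the compact closure; the slack 1 makes the bound open, so that D_m eventually
   lies in G. *)
pose G := U `&` [set z | normc (F z) < M + 1].
have oG : open G.
  rewrite openE => z [Uz Fz]; apply: filterI; first exact: open_nbhs_nbhs.
  have MF : nbhs (normc (F z)) [set` `]-oo, M + 1[].
    by apply: open_nbhs_nbhs; split=> //=; rewrite in_itv.
  have MFz : \forall w \near z, normc (F w) \in `]-oo, M + 1[ by exact: (cF z Uz _ MF).
  by apply: filterS MFz => w; rewrite in_itv.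
have clDG : clD `<=` G.
  move=> z Dz; split; first exact: clDU.
  have /= := FM _ (ex_intro2 _ _ z Dz erefl).
  rewrite ger0_norm ?normc_ge0// => /le_lt_trans; apply; by rewrite ltrDl.
have [_ /(_ G oG clDG)[N _ NP]] := happrox; exists N => // m /= Nm z Dz.
have [_ _ /(_ z (subset_closure Dz))[Uz Fz]] := NP m Nm.
by split=> //; exact: ltW.
Qed.

(** With M a bound of |F| on D_m, the density |F|^2 mu_m is at most |F|^2 mu 1_{cl D} plus M^2 times
    the excess weight, whose integral over D_m is bounded by the one over D_p. Dividing e by M^2 + 1
    covers M = 0. *)
Lemma sqwint_outer (U : set C) (F : C -> R[i]) (e : R) : open U ->
  clD `<=` U -> holomorphic_on U F -> 0 < e ->
  \forall m \near \oo, holomorphic_on (D_ m) F /\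
    (sqwint (D_ m) (mu_ m) F <= sqwint clD mu F + e%:E)%E.
Proof.
move=> oU clDU hF e0; have [M [M0 FM]] := holomorphic_bounded_near oU clDU hF.
have eM0 : 0 < e / (M ^+ 2 + 1) by rewrite divr_gt0// ltr_wpDl ?sqr_ge0.
apply: filterS3 FM hp (excess_weight_integral eM0) => m FM Dmp le_e.
have hFm : holomorphic_on (D_ m) F by move=> z /FM[Uz _]; exact: hF.
split=> //.
have mF := holomorphic_cmeasurable (@oD_ m) hFm.
have mFcl : cmeasurable_fun clD F.
  exact: cmeasurable_funS (open_measurable_Cn oU) clDU (holomorphic_cmeasurable oU hF).
(* Extended by 0 to the whole space, because D_m contains D but possibly not its closure. *)
pose G z : \bar R := if z \in clD then (normc (F z) ^+ 2 * mu z)%:E else 0%E.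
have G0 z : (0 <= G z)%E.
  rewrite /G; case: ifPn => // /set_mem /wmu.2 mu0.
  by rewrite lee_fin mulr_ge0 ?sqr_ge0// ltW.
have mG : measurable_fun setT G.
  exact: (measurable_restrictT _ mclD).1 (sqwint_measurable wmu mFcl).
have sqG : sqwint clD mu F = (\int[dV]_z G z)%E.
  by rewrite /sqwint integral_mkcond; apply: eq_integral => z _; rewrite patchE.
have mex B : measurable B -> measurable_fun B (fun z => (excess_weight m z)%:E).
  by move=> mB; apply/measurable_EFinP; exact: measurable_excess_weight.
have ex0 z : (0 <= (excess_weight m z)%:E)%E.
  by rewrite lee_fin excess_weight_ge0.
have M2 : 0 <= M ^+ 2 by exact: sqr_ge0.
have mGm : measurable_fun (D_ m) G by exact: measurable_funTS.
have mMex : measurable_fun (D_ m) (fun z => (M ^+ 2)%:E * (excess_weight m z)%:E)%E.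
  by apply: measurable_funeM; exact: mex.
have Mex0 z : (0 <= (M ^+ 2)%:E * (excess_weight m z)%:E)%E.
  exact: mule_ge0.
apply: (@le_trans _ _ (\int[dV]_(z in D_ m) (G z + (M ^+ 2)%:E * (excess_weight m z)%:E))%E).
  apply: (ge0_le_integral dV (@mD_ m)).
  - by move=> z Dz; rewrite lee_fin mulr_ge0 ?sqr_ge0// ltW// (wmu_ m).2.
  - exact: sqwint_measurable.
  - exact: emeasurable_funD.
  - move=> z Dz; have [_ FzM] := FM z Dz.
    have F2 : normc (F z) ^+ 2 <= M ^+ 2 by rewrite ler_pXn2r ?nnegrE ?normc_ge0.
    have GE : G z = (normc (F z) ^+ 2 * (if z \in clD then mu z else 0))%:E.
      by rewrite /G; case: ifPn; rewrite ?mulr0.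
    rewrite GE -EFinM -EFinD lee_fin.
    have le_ex : mu_ m z <= (if z \in clD then mu z else 0) + excess_weight m z.
      by rewrite -lerBlDl /excess_weight (mem_set Dz) le_max lexx orbT.
    apply: le_trans (ler_wpM2l (sqr_ge0 _) le_ex) _.
    by rewrite mulrDr lerD2l ler_wpM2r ?excess_weight_ge0.
rewrite (ge0_integralD dV (@mD_ m) (fun z _ => G0 z) mGm (fun z _ => Mex0 z) mMex).
apply: leeD.
  rewrite sqG; exact: (ge0_subset_integral dV (@mD_ m) measurableT mG (fun z _ => G0 z)).
rewrite (ge0_integralZl_EFin dV (@mD_ m) (fun z _ => ex0 z) (mex _ (@mD_ m)) M2).
apply: (@le_trans _ _ ((M ^+ 2)%:E * (e / (M ^+ 2 + 1))%:E)%E).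
  apply: lee_wpmul2l; first by rewrite lee_fin.
  apply: le_trans le_e.
  exact: (ge0_subset_integral dV (@mD_ m) (@mD_ p) (mex _ (@mD_ p)) (fun z _ => ex0 z) Dmp).
rewrite -EFinM lee_fin mulrCA ler_piMr ?(ltW e0)//.
by rewrite ler_pdivrMr ?mul1r ?lerDl// ltr_wpDl.
Qed.

End outer_weights.

(** * Convergence of the kernels *)

Section compact_neighborhoods.
Context {R : realType} {n : nat}.
Local Notation C := (Cn R n).

Lemma compact_rectangle (a b c d : R) : compact [set w : R[i] |
  complex.Re w \in `[a, b] /\ complex.Im w \in `[c, d]].
Proof.
pose g (xy : R * R) : R[i] := Complex xy.1 xy.2.
have gc : continuous g.
  move=> [x y]; apply/(@cvgrPdist_lt _ _ _ (nbhs (x, y))) => e e0.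
  have eR : 0 < complex.Re e by move: e0; rewrite ltcE/= => /andP[].
  have e2 : 0 < complex.Re e / 2 by rewrite divr_gt0.
  exists (ball x (complex.Re e / 2), ball y (complex.Re e / 2)).
    by split; exact: nbhsx_ballx.
  move=> [x' y'] [/= + +]; rewrite -!ball_normE/= => xx' yy'.
  have eE : e = (complex.Re e)%:C%C by rewrite RRe_real// gtr0_real.
  rewrite norm_normc eE ltcR.
  by apply: le_lt_trans (normc_le_ReIm _) _; rewrite /=; lra.
have -> : [set w : R[i] | complex.Re w \in `[a, b] /\ complex.Im w \in `[c, d]] =
    g @` (`[a, b]%classic `*` `[c, d]%classic).
  apply/seteqP; split=> [[x y] [/= xab ycd]|_ [[x y] [/= xab ycd] <-]] //.
  by exists (x, y).
apply: continuous_compact; first exact: continuous_subspaceT.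
by apply: compact_setX; exact: segment_compact.
Qed.

Lemma compact_nbhs_Cn (t : C) (U : set C) : nbhs t U ->
  exists2 K, nbhs t K & compact K /\ K `<=` U.
Proof.
move=> /nbhs_ballP[e /= e0 eU].
have [eI eR] : complex.Im e = 0 /\ 0 < complex.Re e.
  by move: e0; rewrite ltcE/= => /andP[/eqP].
pose d := complex.Re e / 4; have d0 : 0 < d by rewrite divr_gt0.
pose A j := [set w : R[i] |
  complex.Re w \in `[complex.Re (t 0 j) - d, complex.Re (t 0 j) + d] /\
  complex.Im w \in `[complex.Im (t 0 j) - d, complex.Im (t 0 j) + d]].
exists [set v : C | forall j, A j (v ord0 j)]; last split.
- apply/nbhs_ballP; exists d%:C%C => /=; first by rewrite ltcR.
  move=> v [_ tv] j; have := tv 0 j; rewrite -ball_normE/= norm_normc ltcR => vj.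
  have := le_lt_trans (Re_le_normc _) vj; have := le_lt_trans (Im_le_normc _) vj.
  rewrite !raddfB/= !ltr_norml => /andP[? ?] /andP[? ?].
  by split; rewrite in_itv/=; apply/andP; split; lra.
- by apply: rV_compact => j; exact: compact_rectangle.
- move=> v vA; apply: eU; split=> // i j; rewrite (ord1 i).
  rewrite -ball_normE/= norm_normc ltcE/= eI eqxx/=.
  apply: le_lt_trans (normc_le_ReIm _) _; rewrite !raddfB/=.
  have [] := vA j; rewrite !in_itv/= => /andP[? ?] /andP[? ?].
  have : `|complex.Re (t 0 j) - complex.Re (v 0 j)| <= d.
    by rewrite ler_norml; apply/andP; split; lra.
  have : `|complex.Im (t 0 j) - complex.Im (v 0 j)| <= d.
    by rewrite ler_norml; apply/andP; split; lra.
  by rewrite /d; lra.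
Qed.

End compact_neighborhoods.

Lemma locally_uniform_cvgP {R : realType} {T : topologicalType} (A : set T)
    (F : nat -> T -> R[i]) (f : T -> R[i]) :
  (forall x, A x -> exists2 V, nbhs x V & forall e : R, 0 < e ->
    \forall m \near \oo, forall y, V y -> A y ->
      ComplexField.Normc.normc (F m y - f y) < e) ->
  locally_uniform_cvg A F f.
Proof.
move=> FV x Ax; have [V xV VF] := FV x Ax; exists V => //.
move=> P /uniform_nbhs[E [+ EP]]; rewrite -entourage_ballE => -[e /= e0 eE].
have eR : 0 < complex.Re e by move: e0; rewrite ltcE/= => /andP[].
have eE' : e = (complex.Re e)%:C%C by rewrite RRe_real// gtr0_real.
apply: filterS (VF _ eR) => m Fm; apply: EP => y [Vy Ay]; apply: eE => /=.
by rewrite -ball_normE/= norm_normc eE' ltcR normcB_sym; exact: Fm.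
Qed.

(** * Restriction from a larger set and extension by zero *)

Section weights_on_closures.
Context {R : realType} {n : nat}.
Local Notation C := (Cn R n).
Local Notation dV := (lebesgue_Cn R n).
Local Notation normc := ComplexField.Normc.normc.

Lemma admissible_on_weight (E : set C) (mu : C -> R) : measurable E ->
  admissible_on E mu -> weight E mu.
Proof.
move=> mE [W [nu [oW EW admnu numu]]]; have wnu := admissible_weight admnu.
split; last by move=> z Ez; rewrite -numu//; exact/wnu.2/EW.
apply: (@eq_measurable_fun _ _ _ _ _ nu); first by move=> z /set_mem; exact: numu.
exact: measurable_funS (open_measurable_Cn oW) EW wnu.1.
Qed.

Variables (A B : set C) (mu : C -> R).
Hypotheses (mA : measurable A) (mB : measurable B) (AB : A `<=` B).
Hypothesis wmu : weight B mu.

Lemma weightS : weight A mu.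
Proof. by split=> [|z /AB/wmu.2//]; exact: measurable_funS AB wmu.1. Qed.

Lemma L2S f : L2 B mu f -> L2 A mu f /\ wnorm A mu f <= wnorm B mu f.
Proof.
move=> L2f.
have le_f := le_sqwint mA mB weightS wmu AB (fun z _ => lexx (mu z)) L2f.1.
have L2f' : L2 A mu f.
  split; first exact: cmeasurable_funS AB L2f.1.
  exact: le_lt_trans le_f L2f.2.
split=> //; rewrite (sqwint_wnorm weightS L2f') (sqwint_wnorm wmu L2f) lee_fin in le_f.
by move: le_f; rewrite ler_pXn2r// nnegrE; exact: wnorm_ge0.
Qed.

(** Density concerns functions on the closure, while the kernel is meaningful only on D. The value 0
    on the boundary adds no norm. *)
Definition zero_outside (f : C -> R[i]) z := if z \in A then f z else 0.

Lemma L2_zero_outside f : L2 A mu f ->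
  L2 B mu (zero_outside f) /\ wnorm B mu (zero_outside f) = wnorm A mu f.
Proof.
move=> [[mr mi] foo].
have sqE : sqwint B mu (zero_outside f) = sqwint A mu f.
  rewrite /sqwint integral_mkcond [RHS]integral_mkcond; apply: eq_integral => z _.
  rewrite !patchE /zero_outside; have [/set_mem Az|nAz] := ifPn (z \in A).
    by rewrite (mem_set (AB Az)).
  by rewrite ComplexField.Normc.normc0 expr0n mul0r; case: ifP.
split; last by rewrite /wnorm sqE.
split; last by rewrite sqE.
have reE : (fun z => complex.Re (zero_outside f z)) =
    fun z => if z \in A then complex.Re (f z) else 0.
  by apply/funext => z; rewrite /zero_outside; case: ifP.
have imE : (fun z => complex.Im (zero_outside f z)) =
    fun z => if z \in A then complex.Im (f z) else 0.
  by apply/funext => z; rewrite /zero_outside; case: ifP.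
by split; rewrite ?reE ?imE; exact: measurable_fun_if0.
Qed.

Lemma holomorphic_zero_outside f : open A -> holomorphic_on A f ->
  holomorphic_on A (zero_outside f).
Proof.
move=> oA hf z Az; apply: near_eq_differentiable (hf z Az) _.
have : \forall y \near z, A y by exact: open_nbhs_nbhs.
by apply: filterS => y Ay; rewrite /zero_outside mem_set.
Qed.

End weights_on_closures.

(** Here b^2 = k(t), x = |F(y)|, q is the squared norm of F on D_m and k = k_m(y). With K = b^2 and
    s = (b + 1) e one has x >= K - s and q <= K + 2 s. If k < K - eps, then (K - s)^2 <= (K - eps)
    (K + 2 s), which fails as soon as 4 s <= eps. *)
Lemma ratio_lower_bound {R : realFieldType} (b e eps x q k : R) :
  0 <= b -> 0 < e -> e <= 1 -> e * (4 * (b + 1)) <= eps -> eps < b ^+ 2 ->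
  0 <= k -> b ^+ 2 - (b + 1) * e <= x -> x ^+ 2 <= k * q ->
  q <= (b + e) ^+ 2 + e -> b ^+ 2 - eps <= k.
Proof.
move=> b0 e0 e1 eb epsb k0 xb xk qb; rewrite leNgt; apply/negP => kb.
pose s := (b + 1) * e.
have s0 : 0 < s by rewrite mulr_gt0//; lra.
have s4 : 4 * s <= eps by rewrite /s; lra.
have q2 : q <= b ^+ 2 + 2 * s.
  have : e * e <= e by rewrite ler_piMl// ltW.
  by move: qb; rewrite /s !expr2; lra.
rewrite -/s in xb; move: (b ^+ 2) epsb kb xb q2 => K epsK kK xK qK.
have xs : (K - s) ^+ 2 <= x ^+ 2 by rewrite ler_pXn2r ?nnegrE//; lra.
have kq : k * q <= (K - eps) * (K + 2 * s).
  apply: (@le_trans _ _ (k * (K + 2 * s))); first by rewrite ler_wpM2l.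
  by rewrite ler_wpM2r//; lra.
have sK : 4 * s * K <= eps * K by rewrite ler_wpM2r//; lra.
have se : 0 < s * eps by rewrite mulr_gt0//; lra.
by have := le_trans xs (le_trans xk kq); have := sqr_ge0 s; rewrite !expr2; lra.
Qed.

(** * Locally uniform convergence on the diagonal *)

Section outer_approximation.
Context {R : realType} {n : nat}.
Local Notation C := (Cn R n).
Local Notation dV := (lebesgue_Cn R n).
Local Notation normc := ComplexField.Normc.normc.
Variables (D : set C) (D_ : nat -> set C) (mu : C -> R) (mu_ : nat -> C -> R).
Variable p : nat.
Local Notation clD := (closure D).
Hypothesis hDint : D = clD°.
Hypothesis happrox : approximates_from_outside D_ D.
Hypothesis hmu : admissible_on clD mu.
Hypothesis hmuD : admissible D mu.
Hypothesis hmu_ : forall k, admissible (D_ k) (mu_ k).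
Hypothesis hdense : Hext_dense clD mu.
Hypothesis hp : \forall m \near \oo, D_ m `<=` D_ p.
Hypothesis ha : forall m z, (p <= m)%N -> D_ p z ->
  ext_weight_lim D D_ mu mu_ z <= ext_weight D_ mu_ m z <= mu_ p z.
Hypothesis hb : dV.-integrable (D_ p) (EFin \o mu_ p).
Hypothesis hc : {ae dV, forall z, D_ p z ->
  ext_weight D_ mu_ k z @[k --> \oo] --> ext_weight_lim D D_ mu mu_ z}.

Let mclD : measurable clD := closed_measurable_Cn (@closed_closure _ D).
Let mD := admissible_measurable hmuD.
Let DclD : D `<=` clD := @subset_closure _ D.
Let wcl : weight clD mu := admissible_on_weight mclD hmu.
Let wD := admissible_weight hmuD.
Let oD : open D. Proof. by case: hmuD. Qed.
Let oD_ k : open (D_ k). Proof. by case: (hmu_ k). Qed.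
Let wmu_ k : weight (D_ k) (mu_ k) := admissible_weight (hmu_ k).
Let DD_ := happrox.1.

Lemma weight_le_outer m z : (p <= m)%N -> D z -> mu z <= mu_ m z.
Proof.
move=> pm Dz; have /andP[+ _] := ha pm (DD_ p Dz).
by rewrite ext_weight_limE ?(ext_weightE mu_ (DD_ m Dz)); last exact: DclD.
Qed.

(** F approximates the extension of v by 0 on the whole closure. Hence its norm there, boundary
    included, exceeds the norm of v on D by at most e. *)
Lemma holomorphic_approximation (v : C -> R[i]) (e : R) : L2H D mu v -> 0 < e ->
  exists U F, [/\ open U, clD `<=` U, holomorphic_on U F,
    sqwint clD mu F = (wnorm clD mu F ^+ 2)%:E &
    [/\ L2H D mu F, wnorm clD mu F <= wnorm D mu v + e &
      wnorm D mu (fun z => v z - F z) <= e]].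
Proof.
move=> [L2v hv] e0; pose v0 := zero_outside D v.
have [L2v0 nv0] := L2_zero_outside mD mclD DclD L2v.
have hv0 : holomorphic_on clD° v0.
  by rewrite -hDint; exact: holomorphic_zero_outside.
have [g [[L2g _] [U [F [oU clDU hF Fg]]]] v0g] := hdense (conj L2v0 hv0) e0.
have L2F : L2 clD mu F.
  split; last by rewrite (eq_sqwint _ Fg); exact: L2g.2.
  exact: cmeasurable_funS (open_measurable_Cn oU) clDU (holomorphic_cmeasurable oU hF).
have v0F : wnorm clD mu (fun z => v0 z - F z) < e.
  by rewrite (@eq_wnorm _ _ _ _ _ (fun z => v0 z - g z))// => z clDz; rewrite Fg.
have L2v0F := L2B mclD wcl L2v0 L2F.
exists U, F; split; [exact: oU|exact: clDU|exact: hF|exact: (sqwint_wnorm wcl L2F)|].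
split.
- by split; [exact: (L2S mD mclD DclD wcl L2F).1|move=> z /DclD/clDU; exact: hF].
- rewrite (@eq_wnorm _ _ _ _ _ (fun z => v0 z + (F z - v0 z))); last first.
    by move=> z _; rewrite addrC subrK.
  apply: le_trans (wnormD mclD wcl L2v0 (L2B mclD wcl L2F L2v0)) _.
  by rewrite nv0 lerD2l wnormBC; exact: ltW.
- rewrite (@eq_wnorm _ _ _ _ _ (fun z => v0 z - F z)).
    exact: le_trans (L2S mD mclD DclD wcl L2v0F).2 (ltW v0F).
  by move=> z Dz; rewrite /v0 /zero_outside mem_set.
Qed.

Lemma bergman_diag_lower t (eps : R) : D t -> 0 < eps ->
  \forall y \near t & m \near \oo, D y ->
    bergman_diag D mu t - eps <= bergman_diag (D_ m) (mu_ m) y.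
Proof.
move=> Dt eps0.
have [L2v vt k0 nv eK] := bergman_kernelP hmuD Dt.
(* If eps >= k(t), nonnegativity of k_m suffices. Otherwise k(t) > eps > 0, as [ratio_lower_bound]
   requires. *)
have [epsk|keps] := ltP eps (bergman_diag D mu t); last first.
  near=> y m => Dy; have [_ _ km0 _ _] := bergman_kernelP (hmu_ m) (DD_ m Dy).
  by apply: le_trans km0; rewrite subr_le0.
pose b := wnorm D mu (fun z => bergman_kernel D mu z t).
have b0 : 0 <= b by exact: wnorm_ge0.
have bE : bergman_diag D mu t = b ^+ 2 by rewrite nv.
have b1 : 0 < 4 * (b + 1) by lra.
pose e := Num.min 1 (eps / (4 * (b + 1))).
have e0 : 0 < e by rewrite lt_min ltr01 divr_gt0.
have e1 : e <= 1 by rewrite ge_min lexx.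
have eb : e * (4 * (b + 1)) <= eps by rewrite -ler_pdivlMr// ge_min lexx orbT.
move: e e0 e1 eb => e e0 e1 eb.
have [U [F [oU clDU hF sqF [L2F nF vF]]]] := holomorphic_approximation L2v e0.
(* The kernel has value b^2 at t, and evaluation at t has norm b, so an error e in norm costs at
   most b e. Continuity of F costs a further e when t is replaced by y. *)
have Ft : b ^+ 2 - b * e <= normc (F t).
  have := eK _ (L2HB mD wD L2v L2F); rewrite bE -exprMn.
  rewrite ler_pXn2r ?nnegrE ?normc_ge0 ?mulr_ge0 ?wnorm_ge0// => vFt.
  have := le_normcD (F t) (bergman_kernel D mu t t - F t).
  rewrite addrC subrK vt normc_real (ger0_norm k0) bE => h.
  have := le_trans vFt (ler_wpM2l b0 vF); rewrite vt bE.
  by move: h; move: (normc _) (normc _) => x y; lra.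
have Fy : \forall y \near t, b ^+ 2 - (b + 1) * e <= normc (F y).
  have cF : {for t, continuous (fun z => normc (F z))}.
    apply: continuous_comp; last exact: normc_continuous.
    exact/differentiable_continuous/hF/clDU/DclD.
  have /cvgrPdist_lt/(_ e e0) := cF; apply: filterS => y.
  by move=> /(le_lt_trans (ler_norm _)); move: Ft; lra.
have [N _ NP] := sqwint_outer oD_ wmu_ wcl happrox hp ha hb hc oU clDU hF e0.
exists ([set y | b ^+ 2 - (b + 1) * e <= normc (F y)], [set m | (N <= m)%N]).
  by split=> //; exists N.
move=> [y m] [/= {}Fy Nm] Dy; have [hFm sqFm] := NP m Nm.
have [_ _ km0 _ eKm] := bergman_kernelP (hmu_ m) (DD_ m Dy).
have L2Fm : L2H (D_ m) (mu_ m) F.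
  split; last exact: hFm.
  split; first exact: holomorphic_cmeasurable (@oD_ m) hFm.
  by rewrite (le_lt_trans sqFm)// sqF -EFinD ltry.
rewrite bE in epsk *.
apply: (ratio_lower_bound b0 e0 e1 eb epsk km0 Fy (eKm _ L2Fm)).
have := sqFm; rewrite sqF (sqwint_wnorm (wmu_ m) L2Fm.1) -EFinD lee_fin => /le_trans.
by apply; rewrite lerD2r ler_pXn2r ?nnegrE ?wnorm_ge0// addr_ge0// ltW.
Unshelve. all: by end_near. Qed.

(** Both diagonal values at y are compared with k(t), at a cost of half of eps each. The
    neighbourhood of t obtained this way depends on eps. *)
Lemma bergman_diag_gap t (eps : R) : D t -> 0 < eps ->
  \forall y \near t & m \near \oo, D y ->
    bergman_diag D mu y - bergman_diag (D_ m) (mu_ m) y <= eps.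
Proof.
move=> Dt eps0; have e2 : 0 < eps / 2 by rewrite divr_gt0.
have [[A B] /= [tA nB] low] := bergman_diag_lower Dt e2.
exists (A `&` [set y | D y ->
  bergman_diag D mu y <= bergman_diag D mu t + eps / 2], B).
  by split=> //; apply: filterI tA _; exact: bergman_diag_usc.
move=> [y m] [[/= Ay yt] Bm] Dy.
rewrite lerBlDr; apply: le_trans (yt Dy) _.
rewrite [eps in leRHS]splitr -addrA [leRHS]addrC lerD2r addrC -lerBlDr.
exact: low (y, m) (conj Ay Bm) Dy.
Qed.

End outer_approximation.

Unset Implicit Arguments.

Theorem theorem14 (R : realType) (n : nat)
    (D : set (Cn R n)) (D_ : nat -> set (Cn R n))
    (mu : Cn R n -> R) (mu_ : nat -> Cn R n -> R) (p : nat)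
    (hD : domain D) (hDint : D = (closure D)°)
    (hD_ : forall k, domain (D_ k))
    (happrox : approximates_from_outside D_ D)
    (hmu : admissible_on (closure D) mu)
    (hmuD : admissible D mu)
    (hmu_ : forall k, admissible (D_ k) (mu_ k))
    (hdense : Hext_dense (closure D) mu)
    (hp : \forall m \near \oo, D_ m `<=` D_ p)
    (ha : forall m z, (p <= m)%N -> D_ p z ->
       ext_weight_lim D D_ mu mu_ z <= ext_weight D_ mu_ m z <= mu_ p z)
    (hb : (lebesgue_Cn R n).-integrable (D_ p) (EFin \o mu_ p))
    (hc : {ae (lebesgue_Cn R n), forall z, D_ p z ->
       ext_weight D_ mu_ k z @[k --> \oo] --> ext_weight_lim D D_ mu mu_ z}) :
  locally_uniform_cvg (D `*` D)
    (fun m zt => bergman_kernel (D_ m) (mu_ m) zt.1 zt.2)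
    (fun zt => bergman_kernel D mu zt.1 zt.2).
Proof.
have oD : open D by case: hmuD.
apply: locally_uniform_cvgP => -[z0 t0] [/= Dz0 Dt0].
have [K tK [cK KD]] : exists2 K, nbhs t0 K & compact K /\ K `<=` D.
  by apply: compact_nbhs_Cn; exact: open_nbhs_nbhs.
pose M := bergman_diag D mu z0 + 1.
(* The two variables play different roles: near z0 a bound on k is enough, while near t0 the gap k -
   k_m must be uniformly small. *)
pose V := [set z | D z -> bergman_diag D mu z <= M].
have zV : nbhs z0 V by exact: bergman_diag_usc.
have M0 : 0 < M by have [_ _ k0 _ _] := bergman_kernelP hmuD Dz0; rewrite ltr_wpDl.
exists (V `*` K); first by exists (V, K).
move=> e e0.
(* Makes the bound 2 M d on the squared distance equal to e^2 / 2. *)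
pose d := e ^+ 2 / (4 * M).
have d0 : 0 < d by rewrite divr_gt0 ?exprn_gt0 ?mulr_gt0.
(* The neighbourhoods of [bergman_diag_gap] shrink with d, whereas V and K must be fixed before e is
   given; compactness of K yields one rank N for all of K. *)
have /compact_near_coveringP/(_ nat \oo (fun m y => D y ->
  bergman_diag D mu y - bergman_diag (D_ m) (mu_ m) y <= d)) := cK.
case.
  move=> t /KD Dt.
  exact: (bergman_diag_gap hDint happrox hmu hmuD hmu_ hdense hp ha hb hc Dt d0).
move=> N _ NP; exists (maxn N p) => // m; rewrite /= geq_max => /andP[Nm pm].
move=> [z t] [/= Vz Kt] [/= Dz Dt].
have gap := NP m Nm t Kt Dt.
have := bergman_kernel_dist hmuD (hmu_ m) (happrox.1 m)
  (fun z Dz => weight_le_outer happrox ha pm Dz) Dz Dt.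
have [_ _ kz0 _ _] := bergman_kernelP hmuD Dz.
move=> /le_lt_trans dist.
rewrite -(@ltr_pXn2r _ 2)// ?nnegrE ?normc_ge0 ?(ltW e0)//; apply: dist.
apply: (@le_lt_trans _ _ (M * (2 * d))).
  apply: le_trans (_ : bergman_diag D mu z * (2 * d) <= _).
    by rewrite ler_wpM2l// ler_pM2l.
  by apply: ler_wpM2r; [rewrite mulr_ge0// ltW|exact: Vz].
have -> : M * (2 * d) = e ^+ 2 / 2 by rewrite /d; field; rewrite gt_eqF.
by rewrite ltr_pdivrMr// ltr_pMr ?exprn_gt0// ltr1n.
Qed.
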